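(* For any maximal ideal $\mathfrak{p}\subset A$ and any ideal $\mathfrak{a}\subset A$ not contained in $\mathfrak{p}$, there exists a non-zero proper ideal $N$ of $A$ contained in $\mathfrak{a}$, but not in $\mathfrak{p}$, which satisfies the level assumption.
   Context: $\mathbb{F}_q$ is a finite field with $q$ elements. $A$ is an admissible coefficient ring containing $\mathbb{F}_q$, i.e. the ring of elements of a global function field $F\supset\mathbb{F}_q$ that are regular outside one fixed place $\infty$; so $F=\mathrm{Quot}(A)$. For $a\in A\setminus\{0\}$ put $\deg_A(a)=\dim_{\mathbb{F}_q}(A/(a))$, and $\deg_A(0)=-\infty$. For a non-zero ideal $N\subset A$ put $\mathrm{Div}(N)=\{a\in A\mid N\subset (a)\}$. Level assumption on a non-zero proper ideal $N\subset A$: there exists a subset $D\subset\mathrm{Div}(N)$ such that (i) for any $a\in A\setminus\{0\}$ there is $b\in A\setminus\{0\}$ which is a product of elements of $D$ with $\deg_A(a-b)<\deg_A(a)$; (ii) for any distinct $a,b\in D$ we have $ab\in\mathrm{Div}(N)$; (iii) any element of $\mathrm{Div}(N)$ is a product of elements of $D$; (iv) $N$ is principal. *)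

(* Defs.v *)
From HB Require Import structures.
From mathcomp Require Import all_boot all_order all_algebra all_field.
From mathcomp Require Import boolp classical_sets constructive_ereal.
Set Implicit Arguments.
Unset Strict Implicit.
Unset Printing Implicit Defensive.
Import Order.TTheory GRing.Theory Num.Theory.
Local Open Scope classical_set_scope.
Local Open Scope ring_scope.

(* A global function field containing Fq is a finite extension F of the rational
   function field Fq(t), i.e. F : fieldExtType {fraction {poly Fq}}. *)

Definition const_emb (Fq : finFieldType) (F : fieldExtType {fraction {poly Fq}}) :
  Fq -> F := in_alg F \o @tofrac {poly Fq} \o polyC.
HB.instance Definition _ (Fq : finFieldType)
    (F : fieldExtType {fraction {poly Fq}}) :=
  GRing.RMorphism.copy (@const_emb Fq F) (in_alg F \o @tofrac {poly Fq} \o polyC).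

(* A place of F is given by its valuation ring: a proper subring of F containing
   Fq and, for each x in F, at least one of x and x^-1.  For x = 0 the last
   condition is harmless since 0^-1 = 0. *)
Record place (Fq : finFieldType) (F : fieldExtType {fraction {poly Fq}}) :=
  Place {
  regular_at :> {pred F};
  place_subring : subring_closed regular_at;
  place_const : forall c : Fq, const_emb F c \in regular_at;
  place_total : forall x, (x \in regular_at) || (x^-1 \in regular_at);
  place_proper : exists x, x \notin regular_at }.

Definition regular_outside (Fq : finFieldType)
    (F : fieldExtType {fraction {poly Fq}}) (oo : place F) : {pred F} :=
  fun x => `[< forall P : place F, ~ (P =i oo) -> x \in P >].

Lemma regular_outside_subring (Fq : finFieldType)
  (F : fieldExtType {fraction {poly Fq}}) (oo : place F) :
  subring_closed (regular_outside oo).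
Proof.
split.
- by apply/asboolP => P _; have [] := place_subring P.
- move=> x y /asboolP hx /asboolP hy; apply/asboolP => P nP.
  by have [_ + _] := place_subring P; apply; [exact: hx | exact: hy].
- move=> x y /asboolP hx /asboolP hy; apply/asboolP => P nP.
  by have [_ _] := place_subring P; apply; [exact: hx | exact: hy].
Qed.

HB.instance Definition _ (Fq : finFieldType)
    (F : fieldExtType {fraction {poly Fq}}) (oo : place F) :=
  GRing.isSubringClosed.Build F (regular_outside oo)
    (regular_outside_subring oo).

Lemma const_regular_outside (Fq : finFieldType)
  (F : fieldExtType {fraction {poly Fq}}) (oo : place F) (c : Fq) :
  const_emb F c \in regular_outside oo.
Proof. by apply/asboolP => P _; exact: place_const. Qed.

(* The admissible coefficient ring A attached to (F, oo). *)
Record coef_ring (Fq : finFieldType) (F : fieldExtType {fraction {poly Fq}})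
  (oo : place F) := CoefRing {
  coef_val :> F;
  coef_valP : coef_val \in regular_outside oo }.

Section CoefRingStructure.
Variables (Fq : finFieldType) (F : fieldExtType {fraction {poly Fq}}).
Variable oo : place F.
Local Notation A := (coef_ring oo).

HB.instance Definition _ := [isSub for @coef_val Fq F oo].
HB.instance Definition _ := [Choice of A by <:].
HB.instance Definition _ := [SubChoice_isSubComNzRing of A by <:].

Definition coef_scale (c : Fq) (x : A) : A :=
  CoefRing (const_regular_outside oo c) * x.

Let val_scale c x : val (coef_scale c x) = const_emb F c * val x.
Proof. by rewrite /coef_scale rmorphM. Qed.

Fact coef_scaleA b c x :
  coef_scale b (coef_scale c x) = coef_scale (b * c) x.
Proof. by apply: val_inj; rewrite !val_scale rmorphM mulrA. Qed.
Fact coef_scale1 : left_id 1 coef_scale.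
Proof. by move=> x; apply: val_inj; rewrite val_scale rmorph1 mul1r. Qed.
Fact coef_scaleDr : right_distributive coef_scale +%R.
Proof. by move=> c x y; rewrite /coef_scale mulrDr. Qed.
Fact coef_scaleDl x : {morph coef_scale^~ x : b c / b + c}.
Proof.
move=> b c; rewrite /coef_scale -mulrDl; congr (_ * _).
by apply: val_inj; exact: rmorphD.
Qed.
HB.instance Definition _ := GRing.Zmodule_isLmodule.Build Fq A
  coef_scaleA coef_scale1 coef_scaleDr coef_scaleDl.

Fact coef_scaleAl c (x y : A) : c *: (x * y) = (c *: x) * y.
Proof. exact: mulrA. Qed.
HB.instance Definition _ := GRing.Lmodule_isLalgebra.Build Fq A coef_scaleAl.
HB.instance Definition _ := GRing.Lalgebra_isComAlgebra.Build Fq A.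
End CoefRingStructure.

(* Unlike idealr_closed, the unit ideal is allowed. *)
Definition is_ideal (A : comNzRingType) (I : set A) : Prop :=
  I 0 /\ forall c x y : A, I x -> I y -> I (c * x + y).

Definition is_maximal_ideal (A : comNzRingType) (p : set A) : Prop :=
  [/\ is_ideal p, p <> setT &
      forall J : set A, is_ideal J -> p `<=` J -> J = p \/ J = setT].

Definition principal_ideal (A : comNzRingType) (a : A) : set A :=
  [set x | exists c, x = c * a].

(* The classes of v_0, ..., v_(d-1) form a k-basis of A / I. *)
Definition is_basis_mod (k : fieldType) (A : comAlgType k) (I : set A) (d : nat)
    (v : 'I_d -> A) : Prop :=
  forall x : A, exists! c : {ffun 'I_d -> k}, I (x - \sum_i c i *: v i).

(* deg a = dim_k (A / (a)) for a != 0; the value is +oo if this is infinite. *)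
Definition deg (k : fieldType) (A : comAlgType k) (a : A) : \bar int :=
  if a == 0 then -oo%E
  else xget +oo%E [set e : \bar int | exists d : nat,
    (exists v : 'I_d -> A, is_basis_mod (principal_ideal a) v) /\
    e = (d%:Z)%:E].

Definition Div (A : comNzRingType) (N : set A) : set A :=
  [set a | N `<=` principal_ideal a].

(* Repetitions are allowed, and 1 is the empty product. *)
Definition products (A : comNzRingType) (D : set A) : set A :=
  [set b | exists2 s : seq A, (forall x, x \in s -> D x) &
                              b = \prod_(x <- s) x].

Definition level_assumption (k : fieldType) (A : comAlgType k) (N : set A) :
    Prop :=
  exists2 D : set A, D `<=` Div N &
    [/\ forall a : A, a != 0 ->
          exists b : A, [/\ b != 0, products D b & (deg (a - b) < deg a)%E],
        forall a b : A, D a -> D b -> a <> b -> Div N (a * b),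
        Div N `<=` products D &
        exists n : A, N = principal_ideal n].

(* Main.v *)
(* Write v for the valuation of oo and A for the ring of functions regular
   outside oo.

   Counting dimensions shows that A contains some y with a pole at oo.  Degree
   and pole order at oo are related monotonically: if b / a vanishes at oo, then
   dim A/(b) < dim A/(a).  So the approximation condition only asks for products
   that share the leading term of a at oo.  The leading terms modulo powers of y
   form a finite set, because the residue field of oo is finite; hence finitely
   many g_i and y produce all leading terms, and they can be chosen outside p.

   Let x be the product of y, the g_i and an element of the ideal a outside p,
   and let M be the monoid of divisors of powers of x.  Divisibility in M is
   decided by the finitely many places where x vanishes, so by Dickson's lemma
   it is a well quasi-order and M is generated, up to units, by finitely many
   non-units a_i.  Then N = ((prod a_i)^2 x) works, with D the units and the a_i:
   all divisors of its generator lie in M, and any two a_i multiply to a divisor. *)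
From HB Require Import structures.
Require Import Defs.
From mathcomp Require Import all_boot all_order all_algebra all_field.
From mathcomp Require Import boolp classical_sets constructive_ereal.
From mathcomp Require Import zify ring.
Set Implicit Arguments.
Unset Strict Implicit.
Unset Printing Implicit Defensive.
Import Order.TTheory GRing.Theory Num.Theory.
Local Open Scope classical_set_scope.
Local Open Scope ring_scope.

(** * Linear algebra modulo a subspace *)

Section Subspaces.
Variables (k E : fieldType) (phi : {rmorphism k -> E}).

Definition subspace (W : set E) : Prop :=
  [/\ W 0, forall u v, W u -> W v -> W (u + v) &
      forall c u, W u -> W (phi c * u)].

(** Independence of classes in [E / W], without forming the quotient. A general finite index type
    allows pairs (exponent, basis element) as indices. *)
Definition free_mod (W : set E) (I : finType) (v : I -> E) : Prop :=
  forall c : I -> k, W (\sum_i phi (c i) * v i) -> forall i, c i = 0.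

Definition in_span_mod (W : set E) (I : finType) (v : I -> E) (u : E) : Prop :=
  exists c : I -> k, W (u - \sum_i phi (c i) * v i).

Lemma subspace_set0 : subspace [set 0].
Proof. by split=> // [u v /= -> ->|c u /= ->]; rewrite ?addr0 ?mulr0. Qed.

Lemma subspace_sum (W : set E) (I : finType) (F : I -> E) :
  subspace W -> (forall i, W (F i)) -> W (\sum_i F i).
Proof.
by move=> [W0 WD _] WF; elim/big_ind: _ => // i _; exact: WF.
Qed.

Lemma subspaceN (W : set E) u : subspace W -> W u -> W (- u).
Proof.
by move=> [_ _ WZ] /(WZ (-1)); rewrite rmorphN1 mulN1r.
Qed.

Lemma subspaceB (W : set E) u v : subspace W -> W u -> W v -> W (u - v).
Proof.
by move=> sW Wu Wv; have [_ WD _] := sW; apply: WD => //; apply: subspaceN.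
Qed.

(** The coefficient matrix has more rows than columns; a nonzero vector of its left kernel is a
    relation among the [g i] modulo [W]. *)
Lemma span_dependent (W : set E) (I J : finType) (g : I -> E) (h : J -> E) :
    subspace W -> (forall i, in_span_mod W h (g i)) -> (#|J| < #|I|)%N ->
  ~ free_mod W g.
Proof.
move=> sW /choice [a Wa] ltJI free.
pose M := \matrix_(i < #|I|, j < #|J|) a (enum_val i) (enum_val j).
have /rowV0Pn [v /sub_kermxP vM0 /eqP v0] : kermx M != 0.
  rewrite -mxrank_eq0 mxrank_ker -lt0n subn_gt0.
  exact: leq_ltn_trans (rank_leq_col M) ltJI.
apply: v0; apply/rowP => i; rewrite mxE.
rewrite -[i]enum_valK.
apply: (free (fun i => v 0 (enum_rank i))).
have -> : \sum_i phi (v 0 (enum_rank i)) * g i =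
          \sum_i phi (v 0 (enum_rank i)) * (g i - \sum_j phi (a i j) * h j).
  rewrite -[LHS]subr0; under [RHS]eq_bigr do rewrite mulrBr.
  rewrite [RHS]sumrB; congr (_ - _).
  under eq_bigr do rewrite mulr_sumr.
  rewrite exchange_big /= big1 // => j _.
  under eq_bigr do rewrite mulrA -rmorphM.
  rewrite -mulr_suml -rmorph_sum.
  have := congr1 (fun A : 'rV_#|J| => A 0 (enum_rank j)) vM0.
  rewrite !mxE (reindex_onto (@enum_rank I) (@enum_val I predT)) /=; last first.
    by move=> l _; rewrite enum_valK.
  under eq_bigl do rewrite enum_rankK eqxx.
  by under eq_bigr do rewrite mxE !enum_rankK; move=> ->; rewrite rmorph0 mul0r.
have [_ _ WZ] := sW.
by apply: subspace_sum => // l; apply: WZ.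
Qed.

Lemma free_modPn (W : set E) (I : finType) (v : I -> E) : ~ free_mod W v ->
  exists c : I -> k, (exists i, c i != 0) /\ W (\sum_i phi (c i) * v i).
Proof.
move=> /existsNP [c /not_implyP [Wc /existsNP [i /eqP ci]]].
by exists c; split=> //; exists i.
Qed.

Lemma free_mod_span_extend (W : set E) n (v : 'I_n -> E) (u : E) :
    subspace W -> free_mod W v ->
    ~ free_mod W (fun i : 'I_n.+1 => oapp v u (unlift ord0 i)) ->
  in_span_mod W v u.
Proof.
move=> sW fv /free_modPn [c [[i ci]]].
rewrite big_ord_recl unlift_none /=; under eq_bigr => j _ do rewrite liftK /=.
move=> Wc; have [c00|c00] := eqVneq (c ord0) 0.
  move: Wc; rewrite c00 rmorph0 mul0r add0r => /fv cl0.
  by case: (unliftP ord0 i) ci => [j ->|->]; rewrite ?c00 ?cl0 eqxx.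
exists (fun j => - (c ord0)^-1 * c (lift ord0 j)).
have [_ _ WZ] := sW; have := WZ (c ord0)^-1 _ Wc.
rewrite mulrDr mulrA -rmorphM mulVf // rmorph1 mul1r; congr (W (_ + _)).
rewrite mulr_sumr -sumrN; apply: eq_bigr => j _.
by rewrite rmorphM rmorphN mulrA -mulNr -mulNr opprK.
Qed.

Lemma exists_basis_mod (V W : set E) n : subspace W ->
    (forall v : 'I_n -> E, (forall i, V (v i)) -> ~ free_mod W v) ->
  exists m (v : 'I_m -> E),
    [/\ forall i, V (v i), free_mod W v & forall u, V u -> in_span_mod W v u].
Proof.
move=> sW nofree.
pose Q m := `[< exists2 v : 'I_m -> E, (forall i, V (v i)) & free_mod W v >].
have Q0 : Q 0 by apply/asboolP; exists (fun=> 0) => [[]|c _ []].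
have ubQ m : Q m -> (m <= n)%N.
  move=> /asboolP [v Vv fv]; rewrite leqNgt; apply/negP => ltnm.
  apply: (nofree (v \o widen_ord (ltnW ltnm))) => [i|c Wc i]; first exact: Vv.
  pose c' (j : 'I_m) := oapp c 0 (insub (j : nat)).
  have c'E : \sum_j phi (c' j) * v j =
             \sum_j phi (c j) * v (widen_ord (ltnW ltnm) j).
    rewrite (bigID (fun j : 'I_m => (j < n)%N)) /= [X in _ + X]big1 ?addr0.
      rewrite (big_ord_narrow (ltnW ltnm)); apply: eq_bigr => j _.
      by rewrite /c' /= valK.
    by move=> j nj; rewrite /c' insubN // rmorph0 mul0r.
  have := fv c' _ (widen_ord (ltnW ltnm) i).
  by rewrite /c' /= valK /=; apply; rewrite c'E.
case: (ex_maxnP (ex_intro Q _ Q0) ubQ) => m /asboolP [v Vv fv] maxm.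
exists m, v; split=> // u Vu; apply: free_mod_span_extend => // fvu.
suff /maxm : Q m.+1 by rewrite ltnn.
apply/asboolP; exists (fun i => oapp v u (unlift ord0 i)) => // i.
by rewrite /=; case: (unlift ord0 i) => [j|] /=.
Qed.

End Subspaces.

(** * Polynomial expressions in an element of [F], and finiteness over [Fq(z)] *)

Section FiniteExtension.
Variables (Fq : finFieldType) (F : fieldExtType {fraction {poly Fq}}).
Local Notation phi := (@const_emb Fq F).

Definition ev (x : F) (p : {poly Fq}) : F := (map_poly phi p).[x].

Lemma evD x p q : ev x (p + q) = ev x p + ev x q.
Proof. by rewrite /ev rmorphD hornerD. Qed.
Lemma evB x p q : ev x (p - q) = ev x p - ev x q.
Proof. by rewrite /ev rmorphB hornerD hornerN. Qed.
Lemma evM x p q : ev x (p * q) = ev x p * ev x q.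
Proof. by rewrite /ev rmorphM hornerM. Qed.
Lemma evC x c : ev x c%:P = phi c.
Proof. by rewrite /ev map_polyC hornerC. Qed.
Lemma evX x : ev x 'X = x.
Proof. by rewrite /ev map_polyX hornerX. Qed.
Lemma evXn x n : ev x 'X^n = x ^+ n.
Proof. by rewrite /ev map_polyXn hornerXn. Qed.
Lemma ev0 x : ev x 0 = 0.
Proof. by rewrite /ev rmorph0 horner0. Qed.
Lemma ev_coef x p : ev x p = \sum_(i < size p) phi p`_i * x ^+ i.
Proof.
rewrite /ev horner_coef size_map_poly; apply: eq_bigr => i _.
by rewrite coef_map.
Qed.
Lemma ev_poly x n (c : nat -> Fq) :
  ev x (\poly_(i < n) c i) = \sum_(i < n) phi (c i) * x ^+ i.
Proof.
rewrite poly_def /ev rmorph_sum horner_sum; apply: eq_bigr => i _ /=.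
by rewrite map_polyZ map_polyXn hornerZ hornerXn.
Qed.

(** Independence over [Fq[x]]. For [x] algebraic over [Fq] only the empty family qualifies, so
    bounds on such families make sense for every [x]. *)
Definition poly_free (x : F) (I : finType) (r : I -> F) : Prop :=
  forall p : I -> {poly Fq}, \sum_i ev x (p i) * r i = 0 -> forall i, p i = 0.

Let T (p : {poly Fq}) : F := in_alg F (tofrac p).
Let TM p q : T (p * q) = T p * T q. Proof. by rewrite /T !rmorphM. Qed.
Let T_eq0 p : (T p == 0) = (p == 0).
Proof. by rewrite /T fmorph_eq0 tofrac_eq0. Qed.
Let N := \dim {:F}.
Let b (j : 'I_N) : F := (vbasis {:F})`_j.

Lemma fraction_numden (R : idomainType) (u : {fraction R}) :
  exists n d : R, d != 0 /\ u * tofrac d = tofrac n.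
Proof.
elim/quotW: u => x; exists (\n_x), (\d_x); split; first exact: denom_ratioP.
rewrite -[_ * _]/(FracField.mul _ _) !piE; apply/eqmodP => /=.
rewrite FracField.equivfE /FracField.mulf.
rewrite !numden_Ratio ?(mulr1, oner_neq0, denom_ratioP) //.
by rewrite mulrC.
Qed.

Let clear_denominators (I : finType) (f : I -> F) :
  exists2 d : {poly Fq}, d != 0 & exists q : I -> 'I_N -> {poly Fq},
    forall i, T d * f i = \sum_j T (q i j) * b j.
Proof.
have /choice [nd ndP] : forall ij : I * 'I_N, exists nd : {poly Fq} * {poly Fq},
    nd.2 != 0 /\ coord (vbasis {:F}) ij.2 (f ij.1) * tofrac nd.2 = tofrac nd.1.
  by move=> ij; have [n [d [d0 E]]] := fraction_numden
    (coord (vbasis {:F}) ij.2 (f ij.1)); exists (n, d).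
pose D := \prod_ij (nd ij).2.
exists D; first by apply/prodf_neq0 => ij _; have [] := ndP ij.
exists (fun i j => (nd (i, j)).1 * \prod_(ij | ij != (i, j)) (nd ij).2) => i.
rewrite {1}(coord_vbasis (memvf (f i))) mulr_sumr; apply: eq_bigr => j _.
rewrite -/(b j) -[_ *: _]mulr_algl mulrA; congr (_ * _).
rewrite /T -[_%:A]/(in_alg F _) -rmorphM; congr (in_alg F _).
rewrite /D (bigD1 (i, j)) //= !rmorphM /=.
by have [_ /= <-] := ndP (i, j); ring.
Qed.

Let L D f := exists2 q : 'I_N -> {poly Fq},
  forall j, (size (q j) <= D)%N & f = \sum_j T (q j) * b j.

Let L_mul D c d z f (Q : 'I_N -> 'I_N -> {poly Fq}) :
    (forall i, T d * (z * b i) = \sum_j T (Q i j) * b j) ->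
    (forall i j, (size (Q i j) <= c.+1)%N) -> L D f ->
  L (D + c) (T d * z * f).
Proof.
move=> dQ sQ [q sq ->].
exists (fun j => \sum_i q i * Q i j) => [j|].
  apply: (leq_trans (size_sum _ _ _)); apply/bigmax_leqP => i _.
  apply: (leq_trans (size_polyMleq _ _)).
  by have := sQ i j; have := sq i; lia.
rewrite mulr_sumr.
under eq_bigr => i _ do
  rewrite mulrCA -mulrA [T d * _]dQ mulr_sumr.
rewrite exchange_big; apply: eq_bigr => j _ /=.
rewrite /T !rmorph_sum mulr_suml; apply: eq_bigr => i _.
by rewrite mulrA -TM.
Qed.

(* This is [F : Fq(z)] < oo for z transcendental.  In a basis of F over Fq(t),
   multiplication by z raises the t-degree of (denominator-free) coordinates by
   at most c, so z^l r_i for l <= s span a space of dimension N c s + O(s). *)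
Lemma poly_free_bounded (z : F) :
  exists n, forall (I : finType) (r : I -> F), poly_free z r -> (#|I| <= n)%N.
Proof.
have [d d0 [Q dQ]] := clear_denominators (fun j => z * b j).
pose c := maxn (size d) (\max_ij size (Q ij.1 ij.2)).
have sQ i j : (size (Q i j) <= c.+1)%N.
  apply/leqW/(leq_trans _ (leq_maxr _ _)).
  exact: (@leq_bigmax _ (fun ij => size (Q ij.1 ij.2)) (i, j)).
(* Multiplication by [1], written over the same denominator [d], pads the lower powers [z ^+ l] so
   that all of them carry the factor [T d ^+ s]. *)
have d1 i : T d * (1 * b i) = \sum_j T (if i == j then d else 0) * b j.
  rewrite mul1r (bigD1 i) //= eqxx big1 ?addr0 // => j /negPf.
  by rewrite eq_sym => ->; rewrite /T !rmorph0 mul0r.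
have s1 (i j : 'I_N) : (size (if i == j then d else 0%R) <= c.+1)%N.
  by case: eqP => _; rewrite ?size_poly0 //; apply/leqW/leq_maxl.
have Lpow D s l f : (l <= s)%N -> L D f ->
    L (D + s * c) (T d ^+ s * (z ^+ l * f)).
  elim: s l => [|s IH] [|l] // ls Lf; rewrite ?addn0 ?expr0 ?mul1r //.
    have := L_mul d1 s1 (IH 0 (leq0n _) Lf).
    by rewrite mulSnr addnA exprS expr0 mulr1 mulrA mul1r.
  have := L_mul dQ sQ (IH l ls Lf).
  by rewrite mulSnr addnA !exprS; congr (L _ _); ring.
exists (N * c)%N => I r free; rewrite leqNgt; apply/negP => ltNcI.
have [e e0 [R eR]] := clear_denominators r.
pose D := \max_ij size (R ij.1 ij.2).
have Lr i : L D (T e * r i).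
  exists (R i) => [j|]; last exact: eR.
  exact: (@leq_bigmax _ (fun ij => size (R ij.1 ij.2)) (i, j)).
(* There are at least [(N * c + 1) * (s + 1)] elements [g] against [N * (D + s * c)] elements [h];
   [s = N * D] makes the first number larger. *)
pose s := (N * D)%N.
pose C := T d ^+ s * T e.
have C0 : C != 0 by rewrite mulf_neq0 ?expf_neq0 ?T_eq0.
pose g (il : I * 'I_s.+1) := C * (z ^+ il.2 * r il.1).
pose h (ej : 'I_(D + s * c) * 'I_N) := T 'X^(ej.1) * b ej.2.
apply: (@span_dependent _ _ phi [set 0] _ _ g h).
- exact: subspace_set0.
- move=> [i l]; have [q sq E] := Lpow D s l _ (ltn_ord l) (Lr i).
  exists (fun ej : 'I_(D + s * c) * 'I_N => (q ej.2)`_(ej.1)) => /=.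
  apply/eqP; rewrite subr_eq0; apply/eqP.
  transitivity (T d ^+ s * (z ^+ l * (T e * r i))).
    by rewrite /g /C /= -mulrA [T e * _]mulrCA.
  rewrite E -(pair_bigA _ (fun (a : 'I_(D + s * c)) (j : 'I_N) =>
    phi (q j)`_a * h (a, j))) exchange_big.
  apply: eq_bigr => j _ /=.
  have {1}-> : q j = \sum_(a < D + s * c) (q j)`_a *: 'X^a.
    rewrite -poly_def; apply/polyP => a; rewrite coef_poly.
    by case: ltnP => // ha; rewrite nth_default // (leq_trans (sq j)).
  rewrite /T !rmorph_sum mulr_suml; apply: eq_bigr => a _.
  by rewrite -mul_polyC !rmorphM -mulrA.
- rewrite !card_prod !card_ord /s; nia.
- move=> a Wa [i l].
  have : \sum_i0 ev z (\poly_(l < s.+1) a (i0, inord l)) * r i0 = 0.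
    apply/(mulfI C0); rewrite mulr0 mulr_sumr -[RHS]Wa.
    rewrite [RHS](eq_bigr (fun p => phi (a (p.1, p.2)) * g (p.1, p.2))); last first.
      by case.
    rewrite -(pair_bigA _ (fun i l => phi (a (i, l)) * g (i, l))) /=.
    apply: eq_bigr => i0 _; rewrite ev_poly mulr_suml mulr_sumr.
    by apply: eq_bigr => l0 _; rewrite inord_val /g /= -[_ * r i0]mulrA mulrCA.
  move=> /free /(_ i) /polyP /(_ l); rewrite coef_poly coef0 ltn_ord.
  by rewrite inord_val.
Qed.

End FiniteExtension.

HB.instance Definition _ (Fq : finFieldType)
    (F : fieldExtType {fraction {poly Fq}}) (P : place F) :=
  GRing.isSubringClosed.Build F (regular_at P) (place_subring P).

(** * Algebraic relations over [Fq[x]] and quotients of subrings of [F] *)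

Section Relations.
Variables (Fq : finFieldType) (F : fieldExtType {fraction {poly Fq}}).
Local Notation phi := (@const_emb Fq F).
Implicit Types (x f : F) (p : {poly Fq}).

Lemma ev_split x p : exists q, ev x p = phi p.[0] + x * ev x q.
Proof.
have /factor_theorem [q pE] : root (p - p.[0]%:P) 0.
  by rewrite rootE hornerD hornerN hornerC subrr.
exists q; rewrite -[p in LHS](subrK p.[0]%:P) pE subr0 evD evM evC evX.
by rewrite addrC mulrC.
Qed.

(** While all constant terms are zero the relation can be divided by [x], and each division lowers
    the total size of the coefficients. *)
Lemma normalize_relation x (I : finType) (r : I -> F) (p : I -> {poly Fq}) :
    x != 0 -> \sum_i ev x (p i) * r i = 0 -> (exists i, p i != 0) ->
  exists q : I -> {poly Fq},
    (exists i, (q i).[0] != 0) /\ \sum_i ev x (q i) * r i = 0.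
Proof.
move=> x0; have [n] := ubnP (\sum_i size (p i)).
elim: n p => // n IH p /ltnSE szp rel [i0 pi0].
have [[i pi]|/forallNP p00] := pselect (exists i, (p i).[0] != 0).
  by exists p; split=> //; exists i.
have /choice [q pE] : forall i, exists q, p i = q * 'X.
  move=> i; have /factor_theorem [q ->] : root (p i) 0.
    by rewrite rootE; apply/negPn/negP/p00.
  by exists q; rewrite subr0.
have q0 i : p i != 0 -> q i != 0.
  by rewrite pE; apply: contra => /eqP ->; rewrite mul0r.
apply: (IH q).
- apply: leq_trans szp; rewrite (bigD1 i0) //= [leqRHS](bigD1 i0) //=.
  rewrite [in leqRHS]pE size_mulX ?q0 // addSn ltnS.
  rewrite leq_add2l; apply: leq_sum => i _; rewrite pE.
  by have [->|qi] := eqVneq (q i) 0; rewrite ?size_poly0 // size_mulX.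
- apply: (mulfI x0); rewrite mulr0 -[RHS]rel mulr_sumr; apply: eq_bigr => i _.
  by rewrite pE evM evX mulrA [x * _]mulrC.
- by exists i0; apply: q0.
Qed.

Lemma poly_free_normalized x (I : finType) (r : I -> F) : x != 0 ->
    (forall q : I -> {poly Fq}, \sum_i ev x (q i) * r i = 0 ->
       forall i, (q i).[0] = 0) ->
  poly_free x r.
Proof.
move=> x0 H p rel i; apply/eqP/negPn/negP => pi.
have [|q [[j qj] /H /(_ j)]] := normalize_relation x0 rel; first by exists i.
exact/eqP.
Qed.

(** Finiteness of [F] over [Fq(x)] makes the powers of [f] dependent. The nonzero constant term lets
    the relation be used at places where [x] vanishes. *)
Lemma power_relation x f : x != 0 ->
  exists n (p : nat -> {poly Fq}),
    (exists2 i, (i < n)%N & (p i).[0] != 0) /\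
    \sum_(0 <= i < n) ev x (p i) * f ^+ i = 0.
Proof.
move=> x0; have [n bn] := poly_free_bounded x.
have /existsNP [p /not_implyP [rel /existsNP [i /eqP pi]]] :
    ~ poly_free x (fun i : 'I_n.+1 => f ^+ i).
  by move/bn; rewrite card_ord ltnn.
have [|q [[j qj] qrel]] := normalize_relation x0 rel; first by exists i.
exists n.+1, (fun i => q (inord i)); split.
  by exists j => //; rewrite inord_val.
by rewrite big_mkord -[RHS]qrel; apply: eq_bigr => l _; rewrite inord_val.
Qed.

Definition ksubring (R : set F) : Prop :=
  [/\ R 1, forall u v, R u -> R v -> R (u - v),
      forall u v, R u -> R v -> R (u * v) & forall c, R (phi c)].

Lemma ksubring_subspace R : ksubring R -> subspace phi R.
Proof.
move=> [R1 RB RM Rphi].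
have R0 : R 0 by rewrite -(subrr 1); apply: RB.
split=> // [u v Ru Rv|c u Ru]; last exact: RM (Rphi c) Ru.
by rewrite -[v]opprK -[- v]sub0r; apply: (RB) => //; exact: RB.
Qed.

Lemma ksubringX R u n : ksubring R -> R u -> R (u ^+ n).
Proof.
by move=> [R1 _ RM _] Ru; elim: n => // n IH; rewrite exprS; apply: RM.
Qed.

Lemma ksubring_ev R x p : ksubring R -> R x -> R (ev x p).
Proof.
move=> kR Rx; have [_ _ RM Rphi] := kR.
rewrite ev_coef; apply: (subspace_sum (ksubring_subspace kR)) => i.
by apply: RM => //; apply: ksubringX.
Qed.

(** For [x != 0] this is the ideal [xR], kept as a subset of [F]. *)
Definition multiples (R : set F) (x : F) : set F := [set u | R (u / x)].

Lemma multiples_subspace R x : ksubring R -> subspace phi (multiples R x).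
Proof.
move=> /ksubring_subspace [R0 RD RZ]; split; rewrite /multiples /=.
- by rewrite mul0r.
- by move=> u v Ru Rv; rewrite mulrDl; apply: RD.
- by move=> c u Ru; rewrite -mulrA; apply: RZ.
Qed.

(** Modulo [xR] only the constant terms of a relation survive; freeness kills them, and
    normalization does the rest. So [R / xR] has dimension at most [[F : Fq(x)]]. *)
Lemma free_mod_poly_free R x (I : finType) (r : I -> F) :
    ksubring R -> R x -> x != 0 -> (forall i, R (r i)) ->
  free_mod phi (multiples R x) r -> poly_free x r.
Proof.
move=> kR Rx x0 Rr free; apply: poly_free_normalized => // p rel.
have /choice [q qE] := fun i => ev_split x (p i).
apply: (free (fun i => (p i).[0])).
have sR := ksubring_subspace kR; have [_ _ RM _] := kR.
have -> : \sum_i phi (p i).[0] * r i = x * (- \sum_i ev x (q i) * r i).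
  rewrite -[LHS]subr0 -[X in _ - X]rel -sumrB mulrN mulr_sumr -sumrN.
  by apply: eq_bigr => i _; rewrite qE; ring.
rewrite /multiples /= mulrAC mulfV // mul1r.
apply: (subspaceN sR); apply: (subspace_sum sR) => i; apply: RM => //.
exact: ksubring_ev.
Qed.

Lemma exists_basis_multiples R x : ksubring R -> R x -> x != 0 ->
  exists m (v : 'I_m -> F),
    [/\ forall i, R (v i), free_mod phi (multiples R x) v &
        forall u, R u -> in_span_mod phi (multiples R x) v u].
Proof.
move=> kR Rx x0; have [n bn] := poly_free_bounded x.
apply: (@exists_basis_mod _ _ phi R _ n.+1); first exact: multiples_subspace.
move=> v Rv fv; have := bn _ _ (free_mod_poly_free kR Rx x0 Rv fv).
by rewrite card_ord ltnn.
Qed.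

Lemma finite_quotient R x : ksubring R -> R x -> x != 0 ->
  exists (T : finType) (kappa : F -> T),
    forall u v, R u -> R v -> kappa u = kappa v -> R ((u - v) / x).
Proof.
move=> kR Rx x0.
have [m [v [_ _ span]]] := exists_basis_multiples kR Rx x0.
have /choice [c cP] : forall u, exists c : {ffun 'I_m -> Fq},
    R u -> multiples R x (u - \sum_i phi (c i) * v i).
  move=> u; have [/span [c cP]|nRu] := pselect (R u); last by exists [ffun=> 0].
  exists (finfun c) => _; under eq_bigr do rewrite ffunE; exact: cP.
exists {ffun 'I_m -> Fq}, c => u w Ru Rw cE.
have := subspaceB (multiples_subspace x kR) (cP _ Ru) (cP _ Rw).
by rewrite cE opprB addrA subrK.
Qed.

End Relations.

(** * Valuation rings of [F] and integral elements *)

Section Places.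
Variables (Fq : finFieldType) (F : fieldExtType {fraction {poly Fq}}).
Local Notation phi := (@const_emb Fq F).
Implicit Types (P Q : place F) (x f : F) (p : {poly Fq}).

(* Membership in the maximal ideal of P. *)
Definition vanishes P x : bool := (x == 0) || (x^-1 \notin P).

Lemma vanishes_in P x : vanishes P x -> x \in P.
Proof.
case/orP => [/eqP ->|/negPf nx]; first exact: rpred0.
by have := place_total P x; rewrite nx orbF.
Qed.

Lemma vanishesPn P x : vanishes P x = false -> x != 0 /\ x^-1 \in P.
Proof. by move/negbT; rewrite negb_or negbK => /andP. Qed.

Lemma vanishes_notin P x : x \notin P -> vanishes P x^-1.
Proof. by move=> nx; rewrite /vanishes invrK nx orbT. Qed.

Lemma vanishes0 P : vanishes P 0. Proof. by rewrite /vanishes eqxx. Qed.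

Lemma vanishes1 P : vanishes P 1 = false.
Proof. by rewrite /vanishes oner_eq0 invr1 rpred1. Qed.

Lemma vanishesM P x f : f \in P -> vanishes P x -> vanishes P (f * x).
Proof.
move=> Pf vx; apply/negPn/negP => /negbTE /vanishesPn [+ Pi].
rewrite mulf_eq0 negb_or => /andP [f0 x0].
move: vx; rewrite /vanishes (negPf x0) /= => /negP; apply.
by have := rpredM Pf Pi; rewrite invfM mulrA mulfV // mul1r.
Qed.

Lemma vanishesD P x y : vanishes P x -> vanishes P y -> vanishes P (x + y).
Proof.
wlog xy : x y / x / y \in P => [W|].
  have /orP [|] := place_total P (x / y); first exact: W.
  by rewrite invf_div addrC => yx vx vy; apply: W.
have [->|y0] := eqVneq y 0; first by rewrite addr0.
move=> _ vy; have -> : x + y = (x / y + 1) * y by rewrite mulrDl divfK // mul1r.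
by apply: vanishesM => //; apply: rpredD => //; apply: rpred1.
Qed.

Lemma vanishesN P x : vanishes P (- x) = vanishes P x.
Proof. by rewrite /vanishes oppr_eq0 invrN rpredN. Qed.

Lemma vanishes_sum P (I : Type) (r : seq I) (C : pred I) (g : I -> F) :
  (forall i, C i -> vanishes P (g i)) -> vanishes P (\sum_(i <- r | C i) g i).
Proof.
by move=> vg; elim/big_ind: _ => //; [apply: vanishes0|move=> x y; apply: vanishesD].
Qed.

Lemma unit_of_vanishes_sub1 P x : vanishes P (x - 1) -> (x \in P) * (x^-1 \in P) * (x != 0).
Proof.
move=> v; have Px : x \in P.
  by rewrite -[x](subrK 1); apply: rpredD (rpred1 _); apply: vanishes_in.
case vx : (vanishes P x); last by have [-> ->] := vanishesPn vx.
have := vanishesD vx (_ : vanishes P (- (x - 1))).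
by rewrite vanishesN opprB addrCA subrr addr0 vanishes1 => /(_ v).
Qed.

Lemma place_ksubring P : ksubring (fun u => u \in P).
Proof.
split; [exact: rpred1|exact: rpredB|exact: rpredM|exact: place_const].
Qed.

Lemma place_ev P x p : x \in P -> ev x p \in P.
Proof. exact: (ksubring_ev p (place_ksubring P)). Qed.

Lemma vanishes_ev P x p : vanishes P x -> vanishes P (ev x p) = (p.[0] == 0).
Proof.
move=> vx; have [q ->] := ev_split x p.
have vq : vanishes P (x * ev x q).
  rewrite mulrC; apply: (vanishesM _ vx).
  by apply/place_ev/vanishes_in.
have [->|p0] := eqVneq p.[0] 0; first by rewrite rmorph0 add0r.
apply/negP => v; have := vanishesD v (_ : vanishes P (- (x * ev x q))).
rewrite vanishesN addrK => /(_ vq).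
by rewrite /vanishes fmorph_eq0 (negPf p0) -fmorphV place_const.
Qed.

(** Otherwise [f] would exceed every power of [x^-1] at [P], and in an algebraic relation of [f]
    over [Fq[x]] the term of highest degree in [f] would dominate all others. *)
Lemma archimedean P x f : vanishes P x -> x != 0 ->
  exists N, x ^+ N * f \in P.
Proof.
move=> vx x0; apply: contrapT => /forallNP big.
have nPf : f \notin P by apply/negP; have := big 0; rewrite expr0 mul1r.
have f0 : f != 0 by apply: contraNneq nPf => ->; apply: rpred0.
have Pfi : f^-1 \in P by have := place_total P f; rewrite (negPf nPf).
have [n [p [[i1 i1n pi1] rel]]] := power_relation f x0.
pose S e := (e < n)%N && (p e != 0).
have exS : exists e, S e.
  by exists i1; rewrite /S i1n; apply: contraNneq pi1 => ->; rewrite horner0.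
have ubS e : S e -> (e <= n)%N by move=> /andP [/ltnW].
case: (ex_maxnP exS ubS) => e /andP [en pe] maxe.
have [j [u]] := multiplicity_XsubC (p e) 0; rewrite pe /= subr0 rootE => u0 peE.
suff : vanishes P (ev x u) by rewrite vanishes_ev // (negPf u0).
have xj0 : x ^+ j * f ^+ e != 0 by rewrite mulf_neq0 // expf_neq0.
rewrite big_mkord (bigD1 (Ordinal en)) //= in rel.
have -> : ev x u = - \sum_(i < n | i != Ordinal en)
    ev x (p i) * f ^+ i / (x ^+ j * f ^+ e).
  rewrite -mulr_suml; apply: (mulIf xj0); rewrite mulNr divfK //.
  apply/eqP; rewrite -addr_eq0 -[X in _ == X]rel peE evM evXn.
  by rewrite -mulrA.
rewrite vanishesN; apply: vanishes_sum => i; rewrite -val_eqE /= => ie.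
have [ei|leie] := ltnP e i.
  have [->|pi] := eqVneq (p i) 0; first by rewrite ev0 !mul0r vanishes0.
  have := maxe i; rewrite /S ltn_ord pi leqNgt ei => /(_ isT)//.
have ltie : (i < e)%N by rewrite ltn_neqAle ie leie.
have -> : ev x (p i) * f ^+ i / (x ^+ j * f ^+ e) =
    ev x (p i) * f^-1 ^+ (e - i.+1) * (x ^+ j * f)^-1.
  have -> : f ^+ e = f ^+ i * (f ^+ (e - i.+1) * f).
    by rewrite -exprSr -exprD -addSnnS subnKC.
  by rewrite exprVn; field; rewrite !expf_neq0 ?f0 ?x0.
apply: vanishesM; last by apply: vanishes_notin; apply/negP/big.
rewrite rpredM ?rpredX //.
by apply/place_ev/vanishes_in.
Qed.

Lemma small_power P x f : vanishes P x -> f != 0 ->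
  exists N, x ^+ N / f \in P.
Proof.
have [->|x0] := eqVneq x 0; last by move=> vx f0; apply: archimedean.
by move=> _ _; exists 1; rewrite expr1 mul0r rpred0.
Qed.

Let tail (c : nat -> F) f n i := \sum_(i <= j < n) c j * f ^+ (j - i).

Let tailE c f n i : (i < n)%N -> tail c f n i = c i + f * tail c f n i.+1.
Proof.
move=> ltin; rewrite /tail big_ltn // subnn mulr1; congr (_ + _).
rewrite mulr_sumr; apply: eq_big_nat => j /andP [ij _].
by rewrite mulrCA -exprS -subSn.
Qed.

(* If f is in Q the partial Horner sums are clearly in Q; otherwise f^-1 is in
   Q and the recurrence can be run from the other end. *)
Let tail_in Q c f n i : (forall j, c j \in Q) -> tail c f n 0 = 0 ->
  (i <= n)%N -> tail c f n i \in Q.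
Proof.
move=> Qc rel le_in; have /orP [Qf|Qf] := place_total Q f.
  by apply: rpred_sum => j _; exact: rpredM (Qc j) (rpredX _ Qf).
have [f0|f0] := eqVneq f 0.
  by apply: rpred_sum => j _; rewrite f0; exact: rpredM (Qc j) (rpredX _ (rpred0 _)).
elim: i le_in => [_|i IH ltin]; first by rewrite rel rpred0.
have -> : tail c f n i.+1 = f^-1 * (tail c f n i - c i).
  by rewrite (tailE c f ltin) addrC addKr mulKf.
exact: rpredM Qf (rpredB (IH (ltnW ltin)) (Qc i)).
Qed.

(** By the valuative criterion this is the integral closure of [Fq[x]] in [F]; as an intersection of
    valuation rings it is visibly a ring. *)
Definition integral_over x : set F := fun u => forall Q, x \in Q -> u \in Q.

Lemma integral_over_ksubring x : ksubring (integral_over x).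
Proof.
split; first by move=> Q _; exact: rpred1.
- by move=> u v iu iv Q Qx; rewrite rpredB ?iu ?iv.
- by move=> u v iu iv Q Qx; rewrite rpredM ?iu ?iv.
- by move=> c Q _; apply: place_const.
Qed.

Lemma integral_over_self x : integral_over x x. Proof. by []. Qed.

(* Every place over x is the localization of the integral closure of Fq[x] at
   the trace of its maximal ideal. *)
Lemma localization P x f : vanishes P x -> x != 0 -> f \in P ->
  exists b, [/\ integral_over x b, integral_over x (f * b) & ~~ vanishes P b].
Proof.
move=> vx x0 Pf; have [n [p [[i0 i0n pi0] rel]]] := power_relation f x0.
pose c i := ev x (p i).
have cQ Q j : x \in Q -> c j \in Q by apply: place_ev.
have t0 : tail c f n 0 = 0 by rewrite -rel; apply: eq_bigr => j _; rewrite subn0.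
have tQ Q i : x \in Q -> (i <= n)%N -> tail c f n i \in Q.
  by move=> Qx; apply: tail_in => // j; apply: cQ.
(* A Horner sum [tail c f n i.+1] that does not vanish at [P] serves as [b]. If there is none, every
   [c i] vanishes at [P], being a combination of two consecutive sums, although [(p i0).[0] !=
   0]. *)
apply: contrapT => nob.
have vt i : (i <= n)%N -> vanishes P (tail c f n i).
  case: i => [_|i ltin]; first by rewrite t0 vanishes0.
  apply/negPn/negP => nv; apply: nob; exists (tail c f n i.+1); split=> // Q Qx.
    exact: tQ.
  have -> : f * tail c f n i.+1 = tail c f n i - c i.
    by rewrite (tailE c f ltin) addrC addKr.
  exact: rpredB (tQ _ _ Qx (ltnW ltin)) (cQ _ _ Qx).
have : vanishes P (c i0).
  have -> : c i0 = tail c f n i0 - f * tail c f n i0.+1 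
    by rewrite (tailE c f i0n) addrK.
  by rewrite vanishesD ?vanishesN ?vt ?vanishesM ?vt // ltnW.
by rewrite vanishes_ev // (negPf pi0).
Qed.

(** The leading coefficient of a relation of [f] over [Fq[x]] works: it is itself a Horner sum, and
    [f] times a Horner sum differs from the preceding one by a coefficient. *)
Lemma clear_denominator x f : x != 0 ->
  exists2 p, p != 0 & integral_over x (ev x p * f).
Proof.
move=> x0; have [n [p [[i0 i0n pi0] rel]]] := power_relation f x0.
pose S e := (e < n)%N && (p e != 0).
have exS : exists e, S e.
  by exists i0; rewrite /S i0n; apply: contraNneq pi0 => ->; rewrite horner0.
have ubS e : S e -> (e <= n)%N by move=> /andP [/ltnW].
case: (ex_maxnP exS ubS) => e /andP [en pe] maxe; exists (p e) => // Q Qx.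
pose c i := ev x (p i).
have cQ j : c j \in Q by apply: place_ev.
have t0 : tail c f n 0 = 0 by rewrite -rel; apply: eq_bigr => j _; rewrite subn0.
have te : tail c f n e = c e.
  rewrite (tailE c f en) /tail big_nat big1 ?mulr0 ?addr0 // => j /andP [ej jn].
  have [pj|pj] := eqVneq (p j) 0; first by rewrite /c pj ev0 mul0r.
  by have := maxe j; rewrite /S jn pj leqNgt ej => /(_ isT)//.
rewrite -/(c e) -te mulrC; case: e {pe maxe te} en => [_|e en].
  by rewrite t0 mulr0 rpred0.
have -> : f * tail c f n e.+1 = tail c f n e - c e.
  by rewrite (tailE c f (ltnW en)) addrC addKr.
exact: rpredB (tail_in cQ t0 (ltnW (ltnW en))) (cQ e).
Qed.

(** Places have rank one: if [f] is in [Q] but not in [P], a power of [f^-1] is divisible by [x] in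
    [P], which would put [x^-1] into [Q]. *)
Lemma place_maximal P Q x : vanishes P x -> vanishes Q x -> x != 0 ->
  {subset P <= Q} -> {subset Q <= P}.
Proof.
move=> vP vQ x0 PQ f Qf; apply/negPn/negP => nPf.
have [N] := small_power (vanishes_notin nPf) x0.
move/PQ => Qfx; have : x^-1 \in Q.
  have f0 : f != 0 by apply: contraNneq nPf => ->; apply: rpred0.
  have := rpredM (rpredX N Qf) Qfx.
  by rewrite exprVn mulrA mulfV ?mul1r // expf_neq0.
by apply/negP; move: vQ; rewrite /vanishes (negPf x0).
Qed.

(** For [f] in [Q] but not in [P], a denominator [b] of [f] at [Q] has to cancel the pole of [f] at
    [P]. *)
Lemma separate_places P Q x : vanishes P x -> vanishes Q x -> x != 0 ->
  ~ P =i Q ->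
  exists u, [/\ integral_over x u, vanishes P u & ~~ vanishes Q u].
Proof.
move=> vP vQ x0 nPQ.
have [f [Qf nPf]] : exists f, f \in Q /\ f \notin P.
  apply: contrapT => /forallNP nf; apply: nPQ.
  have QP : {subset Q <= P}.
    by move=> f Qf; apply/negPn/negP => nPf; apply: (nf f).
  by move=> f; apply/idP/idP; [apply: (place_maximal vQ vP) | apply: QP].
have [b [ib ifb nvb]] := localization vQ x0 Qf.
exists b; split=> //.
have f0 : f != 0 by apply: contraNneq nPf => ->; apply: rpred0.
rewrite -[b](mulfK f0) [b * f]mulrC; apply: vanishesM; last exact: vanishes_notin.
exact: ifb (vanishes_in vP).
Qed.

(* A place where x vanishes is determined by the image of its maximal ideal in
   the finite quotient of the integral closure of Fq[x] by x. *)
Lemma finitely_many_places x : x != 0 ->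
  exists (J : finType) (Q : J -> place F),
    (forall j, vanishes (Q j) x) /\
    forall P, vanishes P x -> exists j, P =i Q j.
Proof.
move=> x0; have kR := integral_over_ksubring x.
have [T [kappa kP]] := finite_quotient kR (integral_over_self (x:=x)) x0.
pose B P := [set t | `[< exists u,
  [/\ integral_over x u, vanishes P u & kappa u = t] >]]%SET.
pose J := {b : {set T} | `[< exists P, vanishes P x /\ B P = b >]}.
have /choice [Q QP] : forall j : J, exists P, vanishes P x /\ B P = val j.
  by move=> j; have /asboolP := valP j.
exists J, Q; split=> [j|P vP]; first by have [] := QP j.
have hJ : `[< exists P', vanishes P' x /\ B P' = B P >] by apply/asboolP; exists P.
exists (Sub (B P) hJ); have [] := QP (Sub (B P) hJ); move: (Q _) => Q0 vQ BQ.
apply: contrapT => /(separate_places vP vQ x0) [u [iu vu /negP nvu]]; apply: nvu.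
have : kappa u \in B Q0 by rewrite BQ /= inE; apply/asboolP; exists u.
rewrite inE => /asboolP [w [iw vw kE]].
rewrite -[u](subrK w); apply: vanishesD => //.
rewrite -[u - w](divfK x0); apply: (vanishesM _ vQ).
exact: kP iu iw (esym kE) _ (vanishes_in vQ).
Qed.

End Places.

(** * Chevalley's theorem on the existence of places *)

Section Chevalley.
Variables (Fq : finFieldType) (F : fieldExtType {fraction {poly Fq}}).
Local Notation phi := (@const_emb Fq F).

Lemma exprVn_mul (w : F) i n : w != 0 -> (i <= n)%N ->
  w^-1 ^+ i * w ^+ n = w ^+ (n - i).
Proof.
move=> w0 le_in; rewrite -{1}(subnK le_in) exprD mulrC -mulrA -exprMn mulfV //.
by rewrite expr1n mulr1.
Qed.

Lemma maximal_subring_avoiding (R0 : set F) (y : F) : ksubring R0 -> ~ R0 y ->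
  exists R, [/\ ksubring R, R0 `<=` R, ~ R y &
    forall S, ksubring S -> R `<=` S -> ~ S y -> S `<=` R].
Proof.
move=> kR0 nR0y.
pose good S := [/\ ksubring S, R0 `<=` S & ~ S y].
(* Zorn's lemma also asks for the union of the empty chain, hence the extra member [set0]. *)
have [C CP totC|R [Rgood maxR]] := @Zorn_bigcup F [set S | S = set0 \/ good S].
  have [[X0 [CX0 gX0]]|/forallNP noX] := pselect (exists X, C X /\ good X); last first.
    left; apply/seteqP; split=> // u [X CX Xu].
    have [X0|gX] := CP _ CX; first by rewrite X0 in Xu.
    by case: (noX X).
  have joint u v : (\bigcup_(X in C) X) u -> (\bigcup_(X in C) X) v ->
      exists X, [/\ C X, good X, X u & X v].
    move=> [X CX Xu] [Y CY Yv]; have [XY|YX] := totC _ _ CX CY.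
      exists Y; split=> //; last exact: XY.
      by case: (CP _ CY) => // Y0; rewrite Y0 in Yv.
    exists X; split=> //; last exact: YX.
    by case: (CP _ CX) => // Y0; rewrite Y0 in Xu.
  have [[X01 _ _ X0phi] sX0 _] := gX0.
  right; split; last 1 first.
  - by move=> [X CX Xy]; have [X1|[_ _]//] := CP _ CX; rewrite X1 in Xy.
  - split; first by exists X0.
    + move=> u v /joint {}joint /joint [X [CX [[_ XB _ _] _ _] Xu Xv]].
      by exists X => //; apply: XB.
    + move=> u v /joint {}joint /joint [X [CX [[_ _ XM _] _ _] Xu Xv]].
      by exists X => //; apply: XM.
    + by move=> c; exists X0.
  - by move=> u R0u; exists X0 => //; apply: sX0.
have gR : good R.
  case: Rgood => // R_0; exfalso; apply: (maxR R0); last by right; split.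
  rewrite R_0; split=> [u []|]; have [R01 _ _ _] := kR0.
  by move=> /(_ 1 R01).
exists R; have [kR sR nRy] := gR; split=> // S kS RS nSy u Su.
apply: contrapT => nRu; apply: (maxR S).
  by split=> // SR; apply: nRu; apply: SR.
by right; split=> //; apply: subset_trans RS.
Qed.

Section MaximalSubring.
Variables (R : set F) (z : F).
Hypotheses (kR : ksubring R) (Rz : R z) (z0 : z != 0) (nRzV : ~ R z^-1).
Hypothesis maxR : forall S, ksubring S -> R `<=` S -> ~ S z^-1 -> S `<=` R.

Let overR (p : {poly F}) := forall i, R p`_i.

Let sR : subspace phi R. Proof. exact: ksubring_subspace. Qed.
Let R1 : R 1. Proof. by case: kR. Qed.
Let R0 : R 0. Proof. by case: sR. Qed.
Let RD u v : R u -> R v -> R (u + v). Proof. by case: sR => _ + _; apply. Qed.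
Let RB u v : R u -> R v -> R (u - v). Proof. by case: kR => _ + _ _; apply. Qed.
Let RM u v : R u -> R v -> R (u * v). Proof. by case: kR => _ _ + _; apply. Qed.

(** By maximality the ring [R[w]], strictly larger than [R], contains [z^-1]. *)
Let relation_of_notin w : ~ R w -> exists2 p, overR p & z * p.[w] = 1.
Proof.
move=> nRw; pose S u := exists2 p, overR p & p.[w] = u.
have SR u : R u -> S u.
  move=> Ru; exists u%:P; last by rewrite hornerC.
  by move=> i; rewrite coefC; case: eqP.
have kS : ksubring S.
  split; first exact: SR.
  - move=> _ _ [p Rp <-] [q Rq <-]; exists (p - q); last by rewrite hornerD hornerN.
    by move=> i; rewrite coefB; apply: RB.
  - move=> _ _ [p Rp <-] [q Rq <-]; exists (p * q); last by rewrite hornerM.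
    by move=> i; rewrite coefM; apply: (subspace_sum sR) => j; apply: RM.
  - by move=> c; apply: SR; case: kR.
have Sw : S w.
  exists 'X; last by rewrite hornerX.
  by move=> i; rewrite coefX; case: eqP.
have [[p Rp pE]|nS] := pselect (S z^-1).
  by exists p => //; rewrite pE mulfV.
by case: nRw; apply: (maxR kS SR nS).
Qed.

Let one_minus_pow b n : R b -> exists2 b', R b' & (1 - z * b) ^+ n = 1 - z * b'.
Proof.
move=> Rb; elim: n => [|n [b' Rb' IH]]; first by exists 0; rewrite ?mulr0 ?subr0.
exists (b + b' - b * (z * b')); last by rewrite exprS IH; ring.
by apply: RB; [apply: RD | do 2!apply: RM => //].
Qed.

(* z lies in the Jacobson radical of R: a non-invertible 1 - z b would give a
   larger subring avoiding z^-1. *)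
Let radical b : R b -> R (1 - z * b)^-1.
Proof.
move=> Rb; set u := 1 - z * b.
have Ru : R u by apply: RB => //; apply: RM.
have u0 : u != 0.
  apply: contra_notN nRzV; rewrite subr_eq0 eq_sym => /eqP zb.
  by rewrite -[z^-1]mulr1 -zb mulKf.
apply: contrapT => /relation_of_notin [p Rp pE].
have [b' Rb' uE] := one_minus_pow (size p) Rb.
apply: nRzV.
pose s := \sum_(i < size p) p`_i * u ^+ (size p - i).
have Rs : R s by apply: (subspace_sum sR) => i; apply: RM => //; apply: ksubringX.
have zsE : z * s = 1 - z * b'.
  rewrite -uE -/u -[RHS]mul1r -pE horner_coef -mulrA; congr (_ * _).
  rewrite mulr_suml; apply: eq_bigr => i _.
  by rewrite -mulrA exprVn_mul // ltnW.
have -> : z^-1 = s + b'; last exact: RD.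
by apply: (mulfI z0); rewrite mulfV // mulrDr zsE subrK.
Qed.

Let reldeg w n := exists p, [/\ overR p, (size p <= n.+1)%N & z * p.[w] = 1].

Let reldeg0 w : ~ reldeg w 0.
Proof.
move=> [p [Rp sp pE]]; apply: nRzV.
rewrite (size1_polyC sp) hornerC in pE.
by rewrite -[z^-1]mulr1 -pE mulKf.
Qed.

(** With [b] the constant term of [q], [1 - z b] is a unit of [R]. So the relation of [w^-1],
    multiplied by [w ^+ n.+1], expresses [w ^+ n.+1] by lower powers, which are substituted into the
    relation of [w]. *)
Let reldeg_lower w n m : w != 0 -> (m <= n.+1)%N ->
  reldeg w n.+1 -> reldeg w^-1 m -> reldeg w n.
Proof.
move=> w0 mn [p [Rp sp pE]] [q [Rq sq qE]].
set e := (1 - z * q`_0)^-1.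
have Re : R e by exact: radical.
have e0 : 1 - z * q`_0 != 0.
  apply: contra_notN nRzV; rewrite subr_eq0 eq_sym => /eqP zb.
  by rewrite -[z^-1]mulr1 -zb mulKf.
have topE : w ^+ n.+1 = \sum_(i < n.+1) z * e * q`_(n.+1 - i) * w ^+ i.
  rewrite (reindex_inj rev_ord_inj) /=.
  have sq2 : (size q <= n.+2)%N by apply: leq_trans sq _.
  rewrite (horner_coef_wide _ sq2) big_ord_recl expr0 mulr1 mulrDr in qE.
  have {}qE : 1 - z * q`_0 = z * \sum_(i < n.+1) q`_i.+1 * w^-1 ^+ i.+1.
    by rewrite -qE addrC addKr.
  rewrite -[LHS]mul1r -[1 in LHS](mulVf e0) -/e qE.
  rewrite !mulrA [z * e]mulrC mulr_sumr mulr_suml.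
  apply: eq_bigr => i _.
  rewrite (_ : (n.+1 - (n.+1 - i.+1) = i.+1)%N); last by have := ltn_ord i; lia.
  rewrite -!mulrA; congr (_ * (_ * (_ * _))).
  by rewrite exprVn_mul.
exists (\poly_(i < n.+1) (p`_i + p`_n.+1 * (z * e * q`_(n.+1 - i)))); split.
- move=> i; rewrite coef_poly; case: ltnP => // _.
  by apply: RD => //; do 3!apply: RM => //.
- exact: size_poly.
- rewrite -[RHS]pE (horner_coef_wide _ sp) big_ord_recr /= topE mulr_sumr -big_split /=.
  rewrite horner_poly; congr (_ * _); apply: eq_bigr => i _; ring.
Qed.

(** Descent on [n + m]: the larger degree can be lowered until it is zero, which [reldeg0]
    excludes. *)
Let no_relations w n m : w != 0 -> reldeg w n -> reldeg w^-1 m -> False.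
Proof.
have [N] := ubnP (n + m); elim: N w n m => // N IH w n m lenm w0 rw rV.
have [mn|nm] := leqP m n.
  case: n => [|n] in lenm rw mn *; first exact: reldeg0 rw.
  by apply: (IH w n m) => //; apply: reldeg_lower rw rV.
case: m => [|m] // in lenm rV nm *.
apply: (IH w^-1 m n); rewrite ?invr_eq0 ?invrK //.
  by rewrite addnC -ltnS -addSn addSnnS.
by apply: (reldeg_lower (m := n)) rV _; rewrite ?invr_eq0 ?invrK // ltnW.
Qed.

Lemma maximal_subring_valuation w : R w \/ R w^-1.
Proof.
have [Rw|nRw] := pselect (R w); first by left.
have [RwV|nRwV] := pselect (R w^-1); [by right | exfalso].
have w0 : w != 0 by apply: contra_notN nRw => /eqP ->.
have [p Rp pE] := relation_of_notin nRw.
have [q Rq qE] := relation_of_notin nRwV.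
by apply: (no_relations w0 (n := size p) (m := size q)); [exists p|exists q].
Qed.

End MaximalSubring.

(** A subring maximal among those containing [R] but not [y] is a valuation ring; [y^-1] takes the
    part of [z]. *)
Lemma exists_place_avoiding (R : set F) y : ksubring R -> R y^-1 -> y != 0 ->
  ~ R y -> exists P : place F, (forall u, R u -> u \in P) /\ y \notin P.
Proof.
move=> kR RyV y0 nRy.
have [S [kS RS nSy maxS]] := maximal_subring_avoiding kR nRy.
have val := @maximal_subring_valuation S y^-1 kS (RS _ RyV).
rewrite invrK invr_eq0 in val; have {}val := val y0 nSy maxS.
have sS : subring_closed (fun u => `[< S u >]).
  have [S1 SB SM _] := kS.
  split; first exact/asboolP.
    by move=> u v /asboolP Su /asboolP Sv; apply/asboolP/SB.
  by move=> u v /asboolP Su /asboolP Sv; apply/asboolP/SM.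
have cS c : const_emb F c \in (fun u => `[< S u >]).
  by have [_ _ _ Sphi] := kS; apply/asboolP.
have tS u : (u \in (fun u => `[< S u >])) || (u^-1 \in (fun u => `[< S u >])).
  by have [Su|Su] := val u; apply/orP; [left|right]; apply/asboolP.
have pS : exists u, u \notin (fun u => `[< S u >]).
  by exists y; apply/asboolPn.
by exists (Place sS cS tS pS); split; [move=> u /RS Su; apply/asboolP | apply/asboolPn].
Qed.

(** The function [f] lies in [Fq[f^-1]], as otherwise some place would avoid it. Clearing
    denominators there makes a nonzero constant vanish wherever [f] does, so [f] has no zero. *)
Lemma regular_everywhere_inv f : f != 0 ->
  (forall P : place F, f \in P) -> forall P : place F, f^-1 \in P.
Proof.
move=> f0 reg P0; apply/negPn/negP => nfV.
have vf : vanishes P0 f by rewrite /vanishes nfV orbT.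
pose R u := exists p, u = ev f^-1 p.
have kR : ksubring R.
  split; first by exists 1%:P; rewrite evC rmorph1.
  - by move=> _ _ [p ->] [q ->]; exists (p - q); rewrite evB.
  - by move=> _ _ [p ->] [q ->]; exists (p * q); rewrite evM.
  - by move=> c; exists c%:P; rewrite evC.
have [[p pE]|nRf] := pselect (R f); last first.
  have [|P [_]] := exists_place_avoiding kR _ f0 nRf; first by exists 'X; rewrite evX.
  by rewrite reg.
have p0 : p != 0 by apply: contraNneq f0 => p0; rewrite pE p0 ev0.
have [d dE] : exists d, size p = d.+1.
  by case: (size p) (size_poly_eq0 p) => [|d]; [rewrite (negPf p0)|exists d].
have rel : f * f ^+ d = \sum_(i < d.+1) phi p`_i * f ^+ (d - i).
  rewrite {1}pE ev_coef dE mulr_suml; apply: eq_bigr => i _.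
  by rewrite -mulrA exprVn_mul // -ltnS.
rewrite big_ord_recr /= subnn expr0 mulr1 in rel.
have : vanishes P0 (phi p`_d).
  have -> : phi p`_d = f ^+ d * f - \sum_(i < d) phi p`_i * f ^+ (d - i).
    by rewrite -exprSr exprS rel addrAC subrr add0r.
  apply: vanishesD; first exact: vanishesM (rpredX d (reg P0)) vf.
  rewrite vanishesN; apply: vanishes_sum => i _.
  have -> : (d - i = (d - i.+1).+1)%N by rewrite -subSn.
  rewrite exprSr mulrA; apply: vanishesM => //.
  by exact: rpredM (place_const P0 _) (rpredX _ (reg P0)).
rewrite /vanishes fmorph_eq0 -fmorphV place_const orbF.
by rewrite -[d]/d.+1.-1 -dE -/(lead_coef p) lead_coef_eq0 (negPf p0).
Qed.

End Chevalley.

(** * Existence of a function whose only pole is [oo] *)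

Section Nonconstant.
Variables (Fq : finFieldType) (F : fieldExtType {fraction {poly Fq}}).
Local Notation phi := (@const_emb Fq F).
Variable oo : place F.

Lemma regular_outsideP f :
  f \in regular_outside oo <-> forall P : place F, ~ P =i oo -> f \in P.
Proof. by split=> [/asboolP|?]; last exact/asboolP. Qed.

(** Reversing the coefficients up to the common degree bound [D] turns a relation over [Fq[x^-1]]
    into one over [Fq[x]]. *)
Lemma poly_free_inv x (I : finType) (r : I -> F) : x != 0 ->
  poly_free x r -> poly_free x^-1 r.
Proof.
move=> x0 free p rel.
pose D := \max_i size (p i).
have sp i : (size (p i) <= D.+1)%N by apply/leqW/leq_bigmax.
pose q i := \poly_(l < D.+1) (p i)`_(D - l).
have qE i : ev x (q i) = x ^+ D * ev x^-1 (p i).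
  rewrite ev_poly (reindex_inj rev_ord_inj) /= /ev.
  rewrite (@horner_coef_wide _ D.+1) ?size_map_poly // mulr_sumr.
  apply: eq_bigr => l _; rewrite coef_map subSS mulrCA subKn -1?ltnS //.
  by rewrite [_ * _^-1 ^+ _]mulrC exprVn_mul // -ltnS.
have q0 : forall i, q i = 0.
  apply: free; rewrite (eq_bigr (fun i => x ^+ D * (ev x^-1 (p i) * r i))).
    by rewrite -mulr_sumr rel mulr0.
  by move=> i _; rewrite qE mulrA.
move=> i; apply/polyP => l; rewrite coef0.
have [lD|Dl] := leqP l D; last by rewrite nth_default // (leq_trans (sp i)).
have /polyP /(_ (D - l)%N) := q0 i.
by rewrite coef_poly coef0 ltnS leq_subr subKn.
Qed.

(** Only finitely many places are zeros of [x], and the exponents sufficient for each can be added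
    up. *)
Lemma uniform_archimedean x (I : finType) (f : I -> F) : x != 0 ->
  exists N, forall (P : place F) i, vanishes P x -> x ^+ N * f i \in P.
Proof.
move=> x0; have [J [Q [vQ allQ]]] := finitely_many_places x0.
have /choice [N NP] : forall ij : I * J, exists N, x ^+ N * f ij.1 \in Q ij.2.
  by move=> ij; apply: archimedean.
exists (\sum_ij N ij)%N => P i vP; have [j ->] := allQ P vP.
rewrite (bigD1 (i, j)) //= addnC exprD -mulrA.
exact: rpredM (rpredX _ (vanishes_in (vQ j))) (NP (i, j)).
Qed.

Section PoleAtInfinity.
Variable x : F.
Hypotheses (x0 : x != 0) (vx : vanishes oo x).

(** The function is [x^-1] times high powers of functions that vanish at the other zeros of [x] but
    not at [oo]. *)
Lemma exists_pole_only_at_infinity_above :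
  exists2 f, f \notin oo &
    forall P : place F, ~ P =i oo -> vanishes P x -> f \in P.
Proof.
have [J [Q [vQ allQ]]] := finitely_many_places x0.
have /choice [zN zNP] : forall j, exists zN : F * nat,
    [/\ integral_over x zN.1, ~~ vanishes oo zN.1 &
        ~ Q j =i oo -> zN.1 ^+ zN.2 / x \in Q j].
  move=> j; have [Qoo|nQoo] := pselect (Q j =i oo).
    by exists (1, 0); split=> // [P _|]; rewrite ?rpred1 ?vanishes1.
  have [z [iz vz nvz]] := separate_places (vQ j) vx x0 nQoo.
  by have [N] := small_power vz x0; exists (z, N).
pose f := (\prod_j (zN j).1 ^+ (zN j).2) / x.
exists f.
  apply/negP => oof.
  have : \prod_j (zN j).1^-1 ^+ (zN j).2 * f \in oo.
    apply: rpredM => //; apply: rpred_prod => j _; apply: rpredX.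
    by have [_ /negbTE /vanishesPn []] := zNP j.
  rewrite /f mulrA -big_split big1 ?mul1r => [|j _] /=.
    by apply/negP; move: vx; rewrite /vanishes (negPf x0).
  by have [_ /negbTE /vanishesPn [z0 _] _] := zNP j; rewrite exprVn_mul // subnn.
move=> P nP vP; have [j Pj] := allQ P vP.
rewrite Pj /f (bigD1 j) //= mulrAC; apply: rpredM.
  by have [_ _] := zNP j; apply=> Qoo; apply: nP => u; rewrite Pj Qoo.
apply: rpred_prod => l _; apply: rpredX.
by have [iz _ _] := zNP l; apply: iz; apply: vanishes_in.
Qed.

(** The semilocal ring of the zeros of [x] other than [oo]. *)
Let R : set F := fun u => forall P : place F, ~ P =i oo -> vanishes P x -> u \in P.

Let kR : ksubring R.
Proof.
split; first by move=> P _ _; exact: rpred1.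
- by move=> u v Ru Rv P nP vP; rewrite rpredB ?Ru ?Rv.
- by move=> u v Ru Rv P nP vP; rewrite rpredM ?Ru ?Rv.
- by move=> c P _ _; apply: place_const.
Qed.

Let Rx : R x. Proof. by move=> P _; apply: vanishes_in. Qed.

(* Hence R/xR has dimension less than [F : Fq(x)]: this strict inequality comes
   from the pole that f has at oo but nowhere else above x. *)
Let adjoin_pole_free m (r : 'I_m -> F) f :
    f \notin oo -> R f -> (forall i, R (r i)) ->
    free_mod phi (multiples R x) r ->
  exists j, poly_free x (fun i : 'I_m.+1 => oapp r (f ^+ j) (unlift ord0 i)).
Proof.
move=> nf Rf Rr free; have [N NP] := uniform_archimedean r x0.
(* At [oo] the pole of [f ^+ j] is at least that of [x^-1 ^+ N.+1], hence worse than the poles of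
   all [r i]; so its coefficient in a relation has constant term zero. *)
have [j jP] := small_power (vanishes_notin nf) (expf_neq0 N.+1 x0).
exists j; apply: poly_free_normalized => // q.
rewrite big_ord_recl unlift_none /=; under eq_bigr => l _ do rewrite liftK /=.
move=> rel; have sR := ksubring_subspace kR; have [_ RD _] := sR; have [_ _ RM _] := kR.
have q0 : (q ord0).[0] = 0.
  apply/eqP/negPn/negP => q0.
  have vq : vanishes oo (ev x (q ord0)) = false by rewrite vanishes_ev // (negPf q0).
  have [u0 ooV] := vanishesPn vq.
  have : x ^+ N * f ^+ j \in oo.
    have -> : x ^+ N * f ^+ j =
        (ev x (q ord0))^-1 * - \sum_(l < m) ev x (q (lift ord0 l)) * (x ^+ N * r l).
      apply: (mulfI u0); rewrite mulVKf // mulrCA.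
      rewrite (eq_bigr (fun l => x ^+ N * (ev x (q (lift ord0 l)) * r l))); last first.
        by move=> l _; rewrite mulrCA.
      by rewrite -mulr_sumr -mulrN; congr (_ * _); apply/eqP; rewrite -addr_eq0 rel.
    apply: rpredM => //; rewrite rpredN; apply: rpred_sum => l _.
    exact: rpredM (place_ev _ (vanishes_in vx)) (NP _ _ vx).
  move=> oof; have := rpredM oof jP.
  have f0 : f != 0 by apply: contraNneq nf => ->; apply: rpred0.
  have -> : x ^+ N * f ^+ j * (f^-1 ^+ j / x ^+ N.+1) = x^-1.
    rewrite exprVn exprS; field; rewrite x0 ?expf_neq0 //.
  by apply/negP; move: vx; rewrite /vanishes (negPf x0).
have /choice [q' q'E] := fun i => ev_split x (q i).
suff ql l : (q (lift ord0 l)).[0] = 0.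
  by move=> i; case: (unliftP ord0 i) => [l ->|->].
apply: (free (fun l => (q (lift ord0 l)).[0])).
have -> : \sum_(l < m) phi (q (lift ord0 l)).[0] * r l =
    x * - (ev x (q' ord0) * f ^+ j + \sum_(l < m) ev x (q' (lift ord0 l)) * r l).
  rewrite mulrN mulrDr opprD mulr_sumr.
  have -> : x * (ev x (q' ord0) * f ^+ j) = ev x (q ord0) * f ^+ j.
    by rewrite [ev x (q ord0)]q'E q0 rmorph0 add0r mulrA.
  move/eqP: rel; rewrite addr_eq0 => /eqP ->; rewrite opprK -sumrB.
  by apply: eq_bigr => i _; rewrite q'E; ring.
rewrite /multiples /= mulrAC mulfV // mul1r; apply: (subspaceN sR).
apply: RD; first exact: RM (ksubring_ev _ kR Rx) (ksubringX _ kR Rf).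
by apply: (subspace_sum sR) => i; exact: RM (ksubring_ev _ kR Rx) (Rr _).
Qed.

(** Principal parts are removed one power of [x] at a time, which costs [m] generators for each of
    the [k + 1] steps. *)
Let span_bounded_poles m (r : 'I_m -> F) k u :
    (forall v, R v -> in_span_mod phi (multiples R x) r v) -> R (x ^+ k * u) ->
  in_span_mod phi (multiples R x) (fun ej : 'I_k.+1 * 'I_m => x^-1 ^+ ej.1 * r ej.2) u.
Proof.
move=> span.
suff S : R (x ^+ k * u) -> exists a : nat -> 'I_m -> Fq,
    multiples R x (u - \sum_(e < k.+1) \sum_j phi (a e j) * (x^-1 ^+ e * r j)).
  move=> /S [a aP]; exists (fun ej : 'I_k.+1 * 'I_m => a ej.1 ej.2).
  rewrite -(pair_bigA _ (fun (e : 'I_k.+1) j => phi (a e j) * (x^-1 ^+ e * r j))).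
  exact: aP.
elim: k u => [|k IH] u Ru.
  have [c cP] := span _ Ru; exists (fun _ => c); rewrite big_ord_recl big_ord0 addr0.
  move: cP; rewrite expr0 mul1r; congr (multiples R x (_ - _)).
  by apply: eq_bigr => j _; rewrite expr0 mul1r.
have [c cP] := span _ Ru.
pose s := \sum_j phi (c j) * (x^-1 ^+ k.+1 * r j).
have [|a aP] := IH (u - s).
  move: cP; rewrite /multiples /=; congr R.
  rewrite mulrBl mulrBr exprSr mulrAC mulfK // /s mulr_sumr mulr_suml.
  congr (_ - _); apply: eq_bigr => j _.
  by rewrite exprVn exprS; field; rewrite x0 expf_neq0.
exists (fun e => if e == k.+1 then c else a e).
move: aP; congr (multiples R x _); rewrite [in RHS]big_ord_recr /= eqxx -/s.
rewrite opprD addrA addrAC; congr (_ - _ - _).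
by apply: eq_bigr => e _; rewrite ltn_eqF.
Qed.

(* With w = x^-1, h a basis of F over Fq(w) integral over Fq[w], and
   m < n = [F : Fq(w)], the (L+1) n functions w^l h_i for l <= L have their
   principal parts at the places other than oo in a space of dimension
   (L+c+1) m.  For L large some combination has none, and lies in A. *)
Lemma regular_with_pole_of_vanishes :
  exists2 y, y \in regular_outside oo & y \notin oo.
Proof.
pose w := x^-1.
have w0 : w != 0 by rewrite invr_eq0.
have wV : w^-1 = x by rewrite invrK.
have [/regular_outsideP Aw|] := pselect (forall P : place F, ~ P =i oo -> w \in P).
  by exists w => //; move: vx; rewrite /vanishes (negPf x0).
(* The function [y] built below will vanish at this second pole [P0] of [w]; therefore it cannot be
   free of poles. *)
move=> /existsNP [P0 /not_implyP [nP0 /negP nwP0]].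
have [f nf Rf] := exists_pole_only_at_infinity_above.
have [m [r [Rr free span]]] := exists_basis_multiples kR Rx x0.
have [j jfree] := adjoin_pole_free nf Rf Rr free.
have [B bB] := poly_free_bounded w.
pose S n := `[< exists g : 'I_n -> F, poly_free w g >].
have Sm : S m.+1 by apply/asboolP; eexists; apply: poly_free_inv x0 jfree.
have ubS n : S n -> (n <= B)%N by move=> /asboolP [g /bB]; rewrite card_ord.
case: (ex_maxnP (ex_intro S _ Sm) ubS) => n /asboolP [g gfree] maxn.
have {maxn} ltmn := maxn _ Sm.
have /choice [d dP] : forall i, exists d, d != 0 /\ integral_over w (ev w d * g i).
  by move=> i; have [d d0 di] := clear_denominator (g i) w0; exists d.
pose h i := ev w (d i) * g i.
have hfree : poly_free w h.
  move=> p rel i; have := gfree (fun i => p i * d i) _ i.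
  rewrite -[RHS]rel; under eq_bigr => l _ do rewrite evM -mulrA.
  move=> /(_ erefl) /eqP; rewrite mulf_eq0 => /orP [/eqP //|].
  by have [/negPf ->] := dP i.
have [c cP] := uniform_archimedean h x0.
(* As [m < n], this choice gives [(L + 1) * n > (L + c + 1) * m]. *)
pose L := (c * n)%N.
pose G (li : 'I_L.+1 * 'I_n) := w ^+ li.1 * h li.2.
have GR li : R (x ^+ (L + c) * G li).
  case: li => l i P nP vP; rewrite /G /=.
  have lL : (l <= L)%N by rewrite -ltnS.
  have -> : x ^+ (L + c) * (w ^+ l * h i) = x ^+ (L - l) * (x ^+ c * h i).
    by rewrite -(exprVn_mul x0 lL) exprD /w; ring.
  exact: rpredM (rpredX _ (vanishes_in vP)) (cP P i vP).
have := @span_dependent _ _ phi _ _ _ G _ (multiples_subspace x kR)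
  (fun li => span_bounded_poles span (GR li)).
rewrite !card_prod !card_ord => dep.
have /free_modPn [a [[li0 ali0] aP]] : ~ free_mod phi (multiples R x) G.
  by apply: dep; rewrite /L; nia.
set y := \sum_i _ in aP.
have yE : y = \sum_i ev w (\poly_(l < L.+1) a (inord l, i)) * h i.
  rewrite /y (eq_bigr (fun p => phi (a (p.1, p.2)) * G (p.1, p.2))); last by case.
  rewrite -(pair_bigA _ (fun l i => phi (a (l, i)) * G (l, i))) exchange_big /=.
  apply: eq_bigr => i _; rewrite ev_poly mulr_suml; apply: eq_bigr => l _.
  by rewrite inord_val /G /= mulrA.
have y0 : y != 0.
  apply: contraNneq ali0 => y0; rewrite yE in y0.
  have /polyP /(_ li0.1) := hfree _ y0 li0.2.
  by rewrite coef_poly ltn_ord inord_val coef0 -surjective_pairing => ->.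
have yvan (P : place F) : ~ P =i oo -> vanishes P x -> vanishes P y.
  move=> nP vP; rewrite -[y](divfK x0); apply: (vanishesM _ vP).
  exact: aP nP vP.
have yA : y \in regular_outside oo.
  apply/regular_outsideP => P nP; have [wP|nwP] := boolP (w \in P).
    rewrite yE; apply: rpred_sum => i _; apply: rpredM (place_ev _ wP) _.
    by have [_ ] := dP i; apply.
  by apply: vanishes_in; apply: yvan => //; rewrite -wV; apply: vanishes_notin.
exists y => //; apply/negP => ooy.
have ally (P : place F) : y \in P.
  have [Poo|nPoo] := pselect (P =i oo); first by rewrite Poo.
  by move/regular_outsideP: yA; apply.
have := yvan P0 nP0; rewrite -wV vanishes_notin // => /(_ isT).
by rewrite /vanishes (negPf y0) regular_everywhere_inv.
Qed.

End PoleAtInfinity.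

Lemma exists_regular_with_pole :
  exists2 y, y \in regular_outside oo & y \notin oo.
Proof.
have [w nw] := place_proper oo.
have w0 : w != 0 by apply: contraNneq nw => ->; apply: rpred0.
by apply: (@regular_with_pole_of_vanishes w^-1); rewrite ?invr_eq0 // vanishes_notin.
Qed.

End Nonconstant.

(** * Degree, pole order and leading terms in the coefficient ring *)

Section CoefficientRing.
Variables (Fq : finFieldType) (F : fieldExtType {fraction {poly Fq}}).
Local Notation phi := (@const_emb Fq F).
Variable oo : place F.
Local Notation A := (coef_ring oo).

Definition regular_set : set F := fun u => u \in regular_outside oo.

Lemma regular_set_ksubring : ksubring regular_set.
Proof.
split; [exact: rpred1|exact: rpredB|exact: rpredM|].
exact: const_regular_outside.
Qed.

Lemma regular_inv f : f \in regular_outside oo -> f \in oo -> f != 0 ->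
  f^-1 \in regular_outside oo /\ f^-1 \in oo.
Proof.
move=> /regular_outsideP Af oof f0.
have all P : f^-1 \in (P : place F).
  apply: regular_everywhere_inv => // Q.
  have [Qoo|nQoo] := pselect (Q =i oo); first by rewrite Qoo.
  exact: Af.
by split=> //; apply/regular_outsideP.
Qed.

Lemma regular_inv_oo f : f \in regular_outside oo -> f != 0 -> f^-1 \in oo.
Proof.
move=> Af f0; have [oof|noof] := boolP (f \in oo).
  by have [] := regular_inv Af oof f0.
by have := place_total oo f; rewrite (negPf noof).
Qed.

Lemma regular_vanishes_oo f : f \in regular_outside oo -> vanishes oo f -> f = 0.
Proof.
move=> Af; case/orP => [/eqP //|]; have [//|f0] := eqVneq f 0.
by rewrite regular_inv_oo.
Qed.

(** Expansion in base [a]: each digit is a combination of the [e i]. *)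
Lemma span_power_multiples a d (e : 'I_d -> F) k u :
    a != 0 ->
    (forall v, regular_set v -> in_span_mod phi (multiples regular_set a) e v) ->
    regular_set u ->
  in_span_mod phi (multiples regular_set (a ^+ k))
    (fun ji : 'I_k * 'I_d => a ^+ ji.1 * e ji.2) u.
Proof.
move=> a0 span.
suff S : regular_set u -> exists c : nat -> 'I_d -> Fq,
    multiples regular_set (a ^+ k)
      (u - \sum_(j < k) \sum_i phi (c j i) * (a ^+ j * e i)).
  move=> /S [c cP]; exists (fun ji : 'I_k * 'I_d => c ji.1 ji.2).
  rewrite -(pair_bigA _ (fun (j : 'I_k) i => phi (c j i) * (a ^+ j * e i))).
  exact: cP.
elim: k u => [|k IH] u Au.
  by exists (fun _ _ => 0); rewrite big_ord0 subr0 /multiples /= expr0 divr1.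
have [c cP] := span u Au.
have [c' c'P] := IH _ cP.
exists (fun j => if j is j'.+1 then c' j' else c).
move: c'P; rewrite /multiples /=; congr regular_set.
rewrite big_ord_recl [in RHS]opprD [in RHS]addrA exprS invfM [in RHS]mulrA.
congr (_ * _); rewrite [in RHS]mulrBl; congr (_ - _).
  by congr ((_ - _) / _); apply: eq_bigr => i _; rewrite expr0 mul1r.
rewrite mulr_suml; apply: eq_bigr => j _; rewrite mulr_suml.
by apply: eq_bigr => i _; rewrite /= exprS; field.
Qed.

(* If m >= d then, for large k, the (k+1) m independent elements b^j r_i exceed
   k d = dim A/(a^k), so a combination of them is a nonzero multiple of a^k; but
   its pole at oo is too small for that. *)
Lemma free_lt_span a b m d (r : 'I_m -> F) (e : 'I_d -> F) :
    regular_set a -> regular_set b -> a != 0 -> b != 0 ->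
    vanishes oo (b / a) -> (forall i, regular_set (r i)) ->
    free_mod phi (multiples regular_set b) r ->
    (forall u, regular_set u -> in_span_mod phi (multiples regular_set a) e u) ->
  (m < d)%N.
Proof.
move=> Aa Ab a0 b0 vba Ar free span; rewrite ltnNge; apply/negP => dm.
have kA := regular_set_ksubring; have [A1 _ AM _] := kA.
have x0 : b / a != 0 by rewrite mulf_neq0 ?invr_eq0.
have d0 : (0 < d)%N.
  case: d => // in e span dm *; have [c] := span 1 A1.
  rewrite big_ord0 subr0 /multiples /= mul1r => AaV.
  case/eqP: b0; apply: regular_vanishes_oo => //; rewrite -[b](divfK a0) mulrC.
  by apply: vanishesM vba; rewrite -[a]invrK regular_inv_oo ?invr_eq0.
have [C CP] := uniform_archimedean r x0.
pose k := C.+1.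
pose G (ji : 'I_k.+1 * 'I_m) := b ^+ ji.1 * r ji.2.
have AG ji : regular_set (G ji) by apply: AM => //; apply: ksubringX.
have /free_modPn [c [[ji0 cji0] cP]] :
    ~ free_mod phi (multiples regular_set (a ^+ k)) G.
  apply: (span_dependent (multiples_subspace (a ^+ k) kA)
    (fun ji => span_power_multiples k a0 span (AG ji))).
  by rewrite !card_prod !card_ord; nia.
set s := \sum_ji _ in cP.
have sE : s = \sum_(j < k.+1) \sum_i phi (c (j, i)) * (b ^+ j * r i).
  rewrite /s (eq_bigr (fun p => phi (c (p.1, p.2)) * G (p.1, p.2))); last by case.
  by rewrite -(pair_bigA _ (fun j i => phi (c (j, i)) * G (j, i))).
have s0 : s != 0.
  apply: contraNneq cji0 => s0; have rfree := free_mod_poly_free kA Ab b0 Ar free.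
  have /rfree /(_ ji0.2) : \sum_i ev b (\poly_(j < k.+1) c (inord j, i)) * r i = 0.
    rewrite -[RHS]s0 sE exchange_big /=; apply: eq_bigr => i _.
    rewrite ev_poly mulr_suml; apply: eq_bigr => j _.
    by rewrite inord_val mulrA.
  move=> /polyP /(_ ji0.1).
  by rewrite coef_poly ltn_ord inord_val coef0 -surjective_pairing => ->.
have oos : s * (b / a) ^+ C / b ^+ k \in oo.
  rewrite sE mulr_suml mulr_suml; apply: rpred_sum => j _.
  rewrite mulr_suml mulr_suml; apply: rpred_sum => i _.
  have -> : phi (c (j, i)) * (b ^+ j * r i) * (b / a) ^+ C / b ^+ k =
      phi (c (j, i)) * (b^-1 ^+ (k - j) * ((b / a) ^+ C * r i)).
    have jk : (j <= k)%N by rewrite -ltnS.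
    have bV0 : b^-1 != 0 by rewrite invr_eq0.
    rewrite -(exprVn_mul bV0 jk) invrK exprVn -!mulrA; congr (_ * (_ * _)).
    by rewrite mulrC [_ / b ^+ k]mulrC -mulrA.
  apply: rpredM (place_const oo _) (rpredM (rpredX _ _) (CP _ _ vba)).
  exact: regular_inv_oo.
(* The nonzero element [s / a ^+ k] of [A] has an inverse regular at [oo]. Since [k = C + 1],
   multiplying it by the element of [oos] gives [(b / a)^-1], but [b / a] vanishes at [oo]. *)
have := rpredM oos (regular_inv_oo cP _).
have -> : s * (b / a) ^+ C / b ^+ k * (s / a ^+ k)^-1 = (b / a)^-1.
  rewrite /k !exprS expr_div_n; field.
  by rewrite s0 a0 b0 !expf_neq0.
rewrite mulf_neq0 ?invr_eq0 ?expf_neq0 // => /(_ isT).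
by apply/negP; move: vba; rewrite /vanishes (negPf x0).
Qed.

Lemma val_scaler (c : Fq) (u : A) : val (c *: u) = phi c * val u.
Proof. exact: rmorphM. Qed.

Lemma principal_idealE (a u : A) : a != 0 ->
  principal_ideal a u <-> multiples regular_set (val a) (val u).
Proof.
move=> a0; have va0 : val a != 0 by rewrite -(inj_eq val_inj) rmorph0 in a0.
split=> [[c ->]|Aua].
  by rewrite rmorphM /multiples /= mulfK //; apply: valP.
by exists (CoefRing Aua); apply: val_inj; rewrite rmorphM /= divfK.
Qed.

Lemma is_basis_modE (a : A) d (v : 'I_d -> A) : a != 0 ->
  is_basis_mod (principal_ideal a) v <->
  (free_mod phi (multiples regular_set (val a)) (val \o v) /\
   forall u, regular_set u ->
     in_span_mod phi (multiples regular_set (val a)) (val \o v) u).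
Proof.
move=> a0; have sM := multiples_subspace (val a) regular_set_ksubring.
have idE (c : 'I_d -> Fq) (u : A) : principal_ideal a (u - \sum_i c i *: v i) <->
    multiples regular_set (val a) (val u - \sum_i phi (c i) * val (v i)).
  rewrite principal_idealE // rmorphB rmorph_sum.
  by rewrite (eq_bigr _ (fun i _ => val_scaler (c i) (v i))).
split=> [basis|[free span] u].
  split=> [c Wc i|u Au].
    have [c0 [_ c0u]] := basis 0.
    have E1 : c0 = finfun c.
      apply: c0u; apply/idE; rewrite rmorph0 sub0r.
      by apply: (subspaceN sM); under eq_bigr do rewrite ffunE.
    have E2 : c0 = [ffun=> 0].
      apply: c0u; apply/idE; rewrite big1 ?subr0 ?rmorph0.
        by case: sM.
      by move=> j _; rewrite ffunE rmorph0 mul0r.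
    by have /ffunP /(_ i) := etrans (esym E1) E2; rewrite !ffunE.
  have [c [/idE cP _]] := basis (CoefRing Au); exists c; exact: cP.
have [c cP] := span (val u) (valP u).
exists (finfun c); split.
  by apply/idE; under eq_bigr do rewrite ffunE.
move=> c' /idE c'P; apply/ffunP => i; rewrite ffunE; apply/eqP.
rewrite -subr_eq0; apply/eqP; apply: (free (fun i => c i - c' i)).
have := subspaceB sM c'P cP; congr (multiples _ _ _).
rewrite opprB addrC addrA subrK -sumrB.
by apply: eq_bigr => j _; rewrite rmorphB mulrBl.
Qed.

(** Existence of a basis excludes the default [+oo] of [deg], and the basis returned has exactly the
    size that [deg] selects. *)
Lemma exists_deg_basis (a : A) : a != 0 -> exists d (v : 'I_d -> A),
  is_basis_mod (principal_ideal a) v /\ deg a = (d%:Z)%:E.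
Proof.
move=> a0; have va0 : val a != 0 by rewrite -(inj_eq val_inj) rmorph0 in a0.
set S := [set e : \bar int | exists d : nat,
    (exists v : 'I_d -> A, is_basis_mod (principal_ideal a) v) /\ e = (d%:Z)%:E].
have [|d [[v vb] dE]] := @xgetPex _ +oo%E S.
  have [m [v [Av free span]]] := exists_basis_multiples regular_set_ksubring (valP a) va0.
  exists (m%:Z)%:E, m; split=> //.
  by exists (fun i => CoefRing (Av i)); apply/is_basis_modE.
by exists d, v; split=> //; rewrite /deg (negPf a0).
Qed.

Lemma deg_lt (a b : A) : a != 0 -> vanishes oo (val b / val a) ->
  (deg b < deg a)%E.
Proof.
move=> a0 vba; have [d [v [vb ->]]] := exists_deg_basis a0.
have [b0|b0] := eqVneq b 0; first by rewrite b0 /deg eqxx.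
have [m [w [wb ->]]] := exists_deg_basis b0.
have va0 : val a != 0 by rewrite -(inj_eq val_inj) rmorph0 in a0.
have vb0 : val b != 0 by rewrite -(inj_eq val_inj) rmorph0 in b0.
have [_ span] := (is_basis_modE v a0).1 vb.
have [free _] := (is_basis_modE w b0).1 wb.
rewrite lte_fin ltz_nat.
exact: free_lt_span (valP a) (valP b) va0 vb0 vba (fun i => valP (w i)) free span.
Qed.

Section LeadingTerms.
Variable y : F.
Hypothesis noy : y \notin oo.

(* x^(j a) a is the representative of a modulo powers of y that lies in the
   valuation ring of oo but not in x times it; its class modulo x determines the
   leading term, and among elements of X with a given class one of minimal j is
   kept. *)
Lemma finite_leading_terms (X : set F) :
    (forall a, X a -> regular_set a /\ a != 0) ->
  exists2 G : seq F, forall g, g \in G -> X g &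
    forall a, X a -> exists2 g, g \in G &
      exists i, vanishes oo ((a - y ^+ i * g) / a).
Proof.
move=> XA; pose x := y^-1.
have y0 : y != 0 by apply: contraNneq noy => ->; apply: rpred0.
have x0 : x != 0 by rewrite invr_eq0.
have vx : vanishes oo x by apply: vanishes_notin.
have [T [kappa kP]] := finite_quotient (place_ksubring oo) (vanishes_in vx) x0.
have /choice [j jP] : forall a, exists j,
    X a -> x ^+ j * a \in oo /\ x ^+ j * a / x \notin oo.
  move=> a; have [Xa|] := pselect (X a); last by exists 0.
  have [Aa a0] := XA _ Xa.
  case: (ex_minnP (archimedean a vx x0)) => -[|j] oj minj.
    (* At exponent zero minimality says nothing; instead, [a / x] in [oo] would make the nonzero
       element [a] of [A] vanish at [oo], leaving it with a zero but no pole. *)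
    exists 0 => _; split=> //; rewrite expr0 mul1r in oj *.
    apply/negP => oax; case/eqP: a0.
    apply: regular_vanishes_oo => //; rewrite -[a](divfK x0).
    exact: vanishesM.
  exists j.+1 => _; split=> //; rewrite exprS -[x * _ * a]mulrA mulrAC mulfV // mul1r.
  by apply/negP => /minj; rewrite ltnn.
pose Y t a := X a /\ kappa (x ^+ j a * a) = t.
have /choice [o oP] : forall t, exists o : option F,
    if o is Some g then Y t g /\ forall a, Y t a -> (j g <= j a)%N
    else forall a, ~ Y t a.
  move=> t; have [exY|/forallNP noY] := pselect (exists a, Y t a); last by exists None.
  pose S n := `[< exists a, Y t a /\ j a = n >].
  have exS : exists n, S n by have [a Ya] := exY; exists (j a); apply/asboolP; exists a.
  case: (ex_minnP exS) => n /asboolP [g [Yg jg]] minn.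
  exists (Some g); split=> // a Ya; rewrite jg; apply: minn.
  by apply/asboolP; exists a.
exists (pmap o (enum T)).
  by move=> g; rewrite mem_pmap => /mapP [t _ ot]; have := oP t; rewrite -ot => -[[]].
move=> a Xa; pose t := kappa (x ^+ j a * a).
case ot: (o t) (oP t) => [g|]; last by move/(_ a); case.
move=> [[Xg kg] /(_ a) jga]; have {}jga : (j g <= j a)%N by apply: jga.
exists g; first by rewrite mem_pmap -ot map_f // mem_enum.
exists (j a - j g)%N.
have [oa nax] := jP a Xa; have [og _] := jP g Xg.
have [_ a0] := XA _ Xa.
(* The representatives of [a] and [g] agree modulo [x], so their difference is divisible by [x],
   while the representative of [a] is not. *)
have -> : (a - y ^+ (j a - j g) * g) / a =
    (x ^+ j a * a - x ^+ j g * g) / x * (x ^+ j a * a / x)^-1.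
  have yE : y ^+ (j a - j g) * x ^+ j a = x ^+ j g.
    by rewrite -{1}[y]invrK -/x (exprVn_mul x0) ?leq_subr // subKn.
  by rewrite -yE; field; rewrite a0 x0 expf_neq0.
apply: vanishesM; last exact: vanishes_notin.
by apply: kP => //; rewrite kg.
Qed.

End LeadingTerms.
End CoefficientRing.

(** * Well-quasi-orders *)

Section WellQuasiOrder.
Variable T : eqType.
Implicit Types (X : set T) (r : T -> T -> Prop).

(** For a quasi-order [r] this is the well-quasi-order property, in the form with infinite ascending
    subsequences, which passes to intersections of relations. *)
Definition ramsey X r : Prop :=
  forall g : nat -> T, (forall i, X (g i)) ->
  exists2 s : nat -> nat, {homo s : i j / (i < j)%N} &
    forall i j, (i < j)%N -> r (g (s i)) (g (s j)).

Lemma ramsey_sub X X' r r' : X `<=` X' ->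
    (forall a b, X a -> X b -> r' a b -> r a b) -> ramsey X' r' -> ramsey X r.
Proof.
move=> XX' r'r ram g Xg; have [|s smono sr] := ram g; first by move=> i; apply: XX'.
by exists s => // i j ij; apply: r'r => //; apply: sr.
Qed.

(** Passing to a subsequence twice is the step behind Dickson's lemma. *)
Lemma ramseyI X r1 r2 : ramsey X r1 -> ramsey X r2 ->
  ramsey X (fun a b => r1 a b /\ r2 a b).
Proof.
move=> ram1 ram2 g Xg; have [s smono sr] := ram1 g Xg.
have [t tmono tr] := ram2 (g \o s) (fun i => Xg (s i)).
exists (s \o t) => [i j ij|i j ij] /=; first exact/smono/tmono.
by split; [exact/sr/tmono | exact: tr].
Qed.

Lemma ramsey_forall X (J : finType) (r : J -> T -> T -> Prop) :
  (forall j, ramsey X (r j)) -> ramsey X (fun a b => forall j, r j a b).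
Proof.
move=> ram; suff: ramsey X (fun a b => forall j, j \in enum J -> r j a b).
  by apply: ramsey_sub => // a b _ _ rab j; apply: rab; rewrite mem_enum.
elim: (enum J) => [|j s IH]; first by move=> g _; exists id.
apply: ramsey_sub (ramseyI (ram j) IH) => // a b _ _ [rj rs] i.
by rewrite inE => /orP [/eqP ->|/rs].
Qed.

(** Terms are picked greedily: [n] is the first index still available, [m] the index picked, and
    [C n] the condition on the pick. *)
Lemma ramsey_iterate X r :
    (forall g : nat -> T, (forall i, X (g i)) ->
       exists C : nat -> T -> Prop,
         (forall n, exists2 m, (n <= m)%N & C n (g m)) /\
         forall n n' m m', (n <= m < n')%N -> (n' <= m')%N ->
           C n (g m) -> C n' (g m') -> r (g m) (g m')) ->
  ramsey X r.
Proof.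
move=> step g Xg; have [C [exC Cr]] := step g Xg.
have /choice [nxt nxtP] : forall n, exists m, (n <= m)%N /\ C n (g m).
  by move=> n; have [m] := exC n; exists m.
pose start := fix st k := if k is k'.+1 then (nxt (st k')).+1 else 0%N.
have startlt i j : (i < j)%N -> (nxt (start i) < start j)%N.
  elim: j => // j IH; rewrite ltnS leq_eqVlt => /orP [/eqP ->|/IH lt] //=.
  by rewrite ltnS; apply: leq_trans (ltnW lt) (nxtP _).1.
exists (nxt \o start) => [i j ij|i j ij] /=.
  exact: leq_trans (startlt _ _ ij) (nxtP _).1.
apply: (Cr (start i) (start j)); rewrite ?(nxtP _).1 ?startlt //.
- exact: (nxtP _).2.
- exact: (nxtP _).2.
Qed.

(** Each pick is a minimum of [f] over the remaining tail. *)
Lemma ramsey_leq X (f : T -> nat) : ramsey X (fun a b => f a <= f b)%N.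
Proof.
apply: ramsey_iterate => g _.
exists (fun n a => forall m, (n <= m)%N -> (f a <= f (g m))%N); split; last first.
  move=> n n' m m' /andP [nm mn'] nm' min _.
  exact/min/ltnW/(leq_ltn_trans nm)/(leq_trans mn').
move=> n; pose S v := `[< exists2 m, (n <= m)%N & f (g m) = v >].
have exS : exists v, S v by exists (f (g n)); apply/asboolP; exists n.
case: (ex_minnP exS) => v /asboolP [m nm fv] minv; exists m => // m' nm'.
by rewrite fv; apply: minv; apply/asboolP; exists m'.
Qed.

Lemma ramsey_finite X (C : finType) (f : T -> C) : ramsey X (fun a b => f a = f b).
Proof.
apply: ramsey_iterate => g _.
have [c cP] : exists c, forall n, exists2 m, (n <= m)%N & f (g m) = c.
  apply: contrapT => /forallNP noc.
  have /choice [n nP] : forall c, exists n, forall m, (n <= m)%N -> f (g m) <> c.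
    move=> c; have /existsNP [n nP] := noc c; exists n => m nm fc.
    by apply: nP; exists m.
  have len c : (n c <= \sum_c n c)%N by rewrite (bigD1 c) //= leq_addr.
  exact: nP (len _) erefl.
exists (fun _ a => f a = c); split=> // n n' m m' _ _ -> ->; by [].
Qed.

(** Without a finite basis every finite list in [Y] extends by an element above none of its members;
    the resulting sequence contradicts [ramsey]. *)
Lemma ramsey_finite_basis X r (Y : set T) : ramsey X r -> Y `<=` X ->
  exists2 l : seq T, forall a, a \in l -> Y a &
    forall b, Y b -> exists2 a, a \in l & r a b.
Proof.
move=> ram YX; apply: contrapT => nobasis.
have [b0 Yb0] : exists b, Y b.
  apply: contrapT => /forallNP noY; apply: nobasis; exists [::] => // b Yb.
  by case: (noY b).
have /choice [nxt nxtP] : forall l : seq T, exists b, Y b /\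
    ((forall a, a \in l -> Y a) -> forall a, a \in l -> ~ r a b).
  move=> l; have [Yl|nYl] := pselect (forall a, a \in l -> Y a); last by exists b0.
  apply: contrapT => /forallNP nob; apply: nobasis; exists l => // b Yb.
  apply: contrapT => nor; apply: (nob b); split=> // _ a la rab.
  by apply: nor; exists a.
pose L := fix L n := if n is n'.+1 then nxt (L n') :: L n' else [::].
have YL n a : a \in L n -> Y a.
  elim: n => // n IH; rewrite inE => /orP [/eqP ->|/IH //].
  by have [] := nxtP (L n).
have memL i j : (i < j)%N -> nxt (L i) \in L j.
  elim: j => // j IH; rewrite ltnS leq_eqVlt inE => /orP [/eqP ->|/IH ->].
    by rewrite eqxx.
  by rewrite orbT.
have [i|s smono sr] := ram (fun n => nxt (L n)).
  by apply: YX; have [] := nxtP (L i).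
have [_ bad] := nxtP (L (s 1%N)).
by apply: (bad (YL _) _ (memL _ _ (smono 0%N 1%N isT))); apply: sr.
Qed.

End WellQuasiOrder.

(** * Divisibility tested at finitely many places *)

Section Divisibility.
Variables (Fq : finFieldType) (F : fieldExtType {fraction {poly Fq}}).
Implicit Types (P : place F) (x : F).

(* Up to a unit, a is determined by the largest n such that x^n divides it and
   by the class of a / x^n in the finite ring P / xP. *)
Lemma ramsey_place P x : vanishes P x -> x != 0 ->
  ramsey [set a : F | a \in P /\ a != 0] (fun a b => b / a \in P).
Proof.
move=> vx x0.
have [T [kappa kP]] := finite_quotient (place_ksubring P) (vanishes_in vx) x0.
have /choice [nu nuP] : forall a, exists n, a \in P /\ a != 0 ->
    a / x ^+ n \in P /\ a / x ^+ n / x \notin P.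
  move=> a; have [[Pa a0]|] := pselect (a \in P /\ a != 0); last by exists 0%N.
  have [N NP] := small_power vx a0.
  have exn : exists n, a / x ^+ n.+1 \notin P.
    exists N; apply/negP => Pn.
    have := vanishesM (rpredM NP Pn) vx.
    have -> : x ^+ N / a * (a / x ^+ N.+1) * x = 1.
      by rewrite exprS; field; rewrite a0 x0 expf_neq0.
    by rewrite vanishes1.
  case: (ex_minnP exn) => n nP minn; exists n => _; split.
    case: n nP minn => [|n] nP minn; first by rewrite expr0 divr1.
    by apply/negPn/negP => /minn; rewrite ltnn.
  by rewrite -mulrA -invfM -exprSr.
apply: ramsey_sub (ramseyI (@ramsey_leq _ setT nu)
  (@ramsey_finite _ setT _ (fun a => kappa (a / x ^+ nu a)))) => //.
move=> a b [Pa a0] [Pb b0] [leab kE].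
have [Pa' nPa'] := nuP a (conj Pa a0); have [Pb' _] := nuP b (conj Pb b0).
set a' := a / x ^+ nu a in Pa' nPa' kE; set b' := b / x ^+ nu b in Pb' kE.
have a'0 : a' != 0 by rewrite mulf_neq0 ?invr_eq0 ?expf_neq0.
have /unit_of_vanishes_sub1 unit_ab : vanishes P (b' / a' - 1).
  have -> : b' / a' - 1 = (b' - a') / x * (a' / x)^-1 by field; rewrite a'0 x0.
  by apply: vanishesM; [exact: kP | exact: vanishes_notin].
have -> : b / a = x ^+ (nu b - nu a) * (b' / a').
  rewrite -(exprVn_mul x0 leab) exprVn /a' /b'; field.
  by rewrite a0 !expf_neq0.
by rewrite rpredM ?unit_ab ?rpredX ?vanishes_in.
Qed.

Variable oo : place F.
Local Notation A := (coef_ring oo).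

(** The elements of [A] that become units in [A[1/x]]. *)
Definition power_divisor (x : A) : set A :=
  [set a | exists k, principal_ideal a (x ^+ k)].

Lemma coef_val_neq0 (a : A) : (val a != 0) = (a != 0).
Proof. by rewrite -(inj_eq val_inj) rmorph0. Qed.

Lemma power_divisor_neq0 (x a : A) : x != 0 -> power_divisor x a -> a != 0.
Proof.
rewrite -!coef_val_neq0 => x0 [k [c E]]; apply/negP => va0.
have a0 : a = 0 by apply: val_inj; rewrite (eqP va0) rmorph0.
have /eqP := congr1 val E; rewrite a0 mulr0 rmorphXn rmorph0.
by rewrite expf_eq0 => /andP [_]; apply/negP.
Qed.

Lemma ramsey_dvd (x : A) : x != 0 ->
  ramsey (power_divisor x) (fun a b => principal_ideal a b).
Proof.
move=> x0; have vx0 : val x != 0 by rewrite coef_val_neq0.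
have [J [Q [vQ allQ]]] := finitely_many_places vx0.
have nQ j : ~ Q j =i oo.
  move=> Qoo; case/eqP: vx0; apply: (regular_vanishes_oo (valP x)).
  by have := vQ j; rewrite /vanishes Qoo.
have ramQ j : ramsey (power_divisor x) (fun a b : A => val b / val a \in Q j).
  move=> g Mg; have [i|s smono sr] := ramsey_place (vQ j) vx0 (g := val \o g).
    split; last by rewrite coef_val_neq0; apply: power_divisor_neq0 (Mg i).
    by apply: (regular_outsideP _ _).1 (nQ j); apply: valP.
  by exists s.
apply: ramsey_sub (ramsey_forall ramQ) => // a b Ma Mb rab.
apply/principal_idealE; first exact: power_divisor_neq0 Ma.
apply/regular_outsideP => P nP.
have [vP|/negbTE vP] := boolP (vanishes P (val x)).
  by have [j ->] := allQ P vP; apply: rab.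
(* Where [x] does not vanish, the divisor [a] of [x ^+ k] is a unit, with inverse [c / x ^+ k]. *)
have [_ PxV] := vanishesPn vP; have [k [c E]] := Ma.
have inP (u : A) : val u \in P by apply: (regular_outsideP _ _).1 nP; apply: valP.
apply: rpredM => //; rewrite (_ : (val a)^-1 = val c * (val x)^-1 ^+ k).
  by rewrite rpredM ?rpredX.
have := congr1 val E; rewrite rmorphXn rmorphM /= => xE.
have a0 : val a != 0 by rewrite coef_val_neq0; apply: power_divisor_neq0 Ma.
apply: (mulIf a0); rewrite mulVf // mulrAC -xE exprVn mulfV // expf_neq0 //.
Qed.

End Divisibility.

(** * Principal ideals and maximal ideals *)

Section Ideals.
Variable A : comNzRingType.
Implicit Types (p : set A) (a b c : A).

Lemma idealM p c a : is_ideal p -> p a -> p (c * a).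
Proof. by move=> [p0 pD] pa; rewrite -[c * a]addr0; apply: pD. Qed.

Lemma idealB p a b : is_ideal p -> p a -> p b -> p (a - b).
Proof.
by move=> [p0 pD] pa pb; rewrite addrC -mulN1r; apply: pD.
Qed.

Lemma principal_is_ideal a : is_ideal (principal_ideal a).
Proof.
split; first by exists 0; rewrite mul0r.
by move=> c _ _ [u ->] [v ->]; exists (c * u + v); rewrite mulrDl mulrA.
Qed.

Lemma principal_trans a b c :
  principal_ideal a b -> principal_ideal b c -> principal_ideal a c.
Proof. by move=> [u ->] [v ->]; exists (v * u); rewrite mulrA. Qed.

Lemma principal_mul a b c d :
  principal_ideal a b -> principal_ideal c d -> principal_ideal (a * c) (b * d).
Proof. by move=> [u ->] [v ->]; exists (u * v); rewrite mulrACA. Qed.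

Lemma principal_mulr a b : principal_ideal a (a * b).
Proof. by exists b; rewrite mulrC. Qed.

Lemma principal_prod (l : seq A) a : a \in l -> principal_ideal a (\prod_(b <- l) b).
Proof.
elim: l => // b l IH; rewrite inE big_cons => /orP [/eqP ->|/IH [c ->]].
  exact: principal_mulr.
by exists (b * c); rewrite mulrA.
Qed.

Lemma Div_principal n a : Div (principal_ideal n) a <-> principal_ideal a n.
Proof.
split=> [|an b nb]; last exact: principal_trans nb.
by apply; exists 1; rewrite mul1r.
Qed.

Lemma maximal_ideal_proper p : is_maximal_ideal p -> ~ p 1.
Proof.
move=> [ip pT _] p1; apply: pT; apply/seteqP; split=> // a _.
by rewrite -[a]mulr1; apply: idealM.
Qed.

Lemma maximal_ideal_prime p a b :
  is_maximal_ideal p -> ~ p a -> ~ p b -> ~ p (a * b).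
Proof.
move=> mp npa npb pab; have [ip pT maxp] := mp; have [p0 pD] := ip.
pose J := [set u | exists c q, p q /\ u = c * a + q].
have iJ : is_ideal J.
  split; first by exists 0, 0; rewrite mul0r addr0.
  move=> c _ _ [c1 [q1 [pq1 ->]]] [c2 [q2 [pq2 ->]]].
  by exists (c * c1 + c2), (c * q1 + q2); split; [apply: pD | ring].
have pJ : p `<=` J by move=> q pq; exists 0, q; rewrite mul0r add0r.
have [JE|JE] := maxp J iJ pJ.
  by apply: npa; rewrite -JE; exists 1, 0; rewrite mul1r addr0.
have [c [q [pq E]]] : J 1 by rewrite JE.
apply: npb; rewrite -[b]mul1r E mulrDl -mulrA; apply: pD => //.
by rewrite mulrC; apply: idealM.
Qed.

Lemma maximal_ideal_prod p (l : seq A) : is_maximal_ideal p ->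
  (forall a, a \in l -> ~ p a) -> ~ p (\prod_(a <- l) a).
Proof.
move=> mp; elim: l => [|a l IH] npl.
  by rewrite big_nil; apply: maximal_ideal_proper.
rewrite big_cons; apply: maximal_ideal_prime => //.
  by apply: npl; rewrite inE eqxx.
by apply: IH => b lb; apply: npl; rewrite inE lb orbT.
Qed.

End Ideals.

(** * Generators of the divisor monoid, leading terms outside [p], and the choice of [N] *)

Section LevelAssumption.
Variables (Fq : finFieldType) (F : fieldExtType {fraction {poly Fq}}).
Variable oo : place F.
Local Notation A := (coef_ring oo).

(** Without a pole at [oo], [u] has no pole at all and hence no zero. This is how units are
    recognized in the set of generators. *)
Lemma coef_unit (u : A) : u != 0 -> val u \in oo -> exists v, v * u = 1.
Proof.
move=> u0 oou; have vu0 : val u != 0 by rewrite coef_val_neq0.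
have [Av _] := regular_inv (valP u) oou vu0.
by exists (CoefRing Av); apply: val_inj; rewrite rmorphM rmorph1 /= mulVf.
Qed.

(** The list is a finite basis, for divisibility, of the members with a pole at [oo]. Dividing by
    one of them lowers [deg], so induction on the degree ends at a unit. *)
Lemma power_divisor_generated (x : A) : x != 0 ->
  exists2 l : seq A, forall a, a \in l -> power_divisor x a &
    forall b, power_divisor x b ->
      products [set a | a \in l \/ (a != 0 /\ val a \in oo)] b.
Proof.
move=> x0.
have [|l lY basis] := ramsey_finite_basis (ramsey_dvd x0)
    (Y := [set a | power_divisor x a /\ val a \notin oo]).
  by move=> a [].
exists l => [a /lY []//|]; set D := [set a | _].
suff main d b : power_divisor x b -> deg b = (d%:Z)%:E -> products D b.
  move=> b Mb; have [d [_ [_ dE]]] := exists_deg_basis (power_divisor_neq0 x0 Mb).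
  exact: main dE.
have [n] := ubnP d; elim: n d b => // n IH d b /ltnSE ledn Mb dE.
have b0 := power_divisor_neq0 x0 Mb.
have [oob|noob] := boolP (val b \in oo).
  exists [:: b]; last by rewrite big_seq1.
  by move=> a; rewrite inE => /eqP ->; right.
have [a la [c cE]] := basis b (conj Mb noob).
have [Ma noa] := lY a la.
have Mc : power_divisor x c.
  have [k bk] := Mb; exists k; apply: principal_trans bk.
  by rewrite cE; apply: principal_mulr.
have c0 := power_divisor_neq0 x0 Mc; have a0 := power_divisor_neq0 x0 Ma.
have [d' [_ [_ d'E]]] := exists_deg_basis c0.
have : (deg c < deg b)%E.
  apply: deg_lt => //; rewrite cE rmorphM invfM mulrA mulfV ?coef_val_neq0 //.
  by rewrite mul1r; apply: vanishes_notin.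
rewrite d'E dE lte_fin ltz_nat => ltd.
have [s sD sE] := IH d' c (leq_trans ltd ledn) Mc d'E.
exists (a :: s); last by rewrite big_cons -sE cE mulrC.
by move=> u; rewrite inE => /orP [/eqP ->|/sD]; first by left.
Qed.

(** If [y] has a pole at [oo], so does [y + 1], and [p] cannot contain both. *)
Lemma exists_coef_notin_maximal (p : set A) : is_maximal_ideal p ->
  exists y : A, ~ p y /\ val y \notin oo.
Proof.
move=> mp; have [ip _ _] := mp.
have [y0 Ay noy] := exists_regular_with_pole oo; pose y := CoefRing Ay.
have [py|npy] := pselect (p y); last by exists y.
exists (y + 1); split.
  move=> py1; apply: (maximal_ideal_proper mp).
  by have := idealB ip py1 py; rewrite addrAC subrr add0r.
apply: contra noy; rewrite rmorphD rmorph1 => oo1.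
by have := rpredB oo1 (rpred1 oo); rewrite addrK.
Qed.

(** The leading terms of elements outside [p] are finitely generated. A nonzero [a] in [p] is not a
    unit, so it has a pole at [oo]; then [a + 1] lies outside [p] and has the same leading term. *)
Lemma leading_terms_notin_maximal (p : set A) (y : A) :
    is_maximal_ideal p -> val y \notin oo ->
  exists2 G : seq A, forall g, g \in G -> ~ p g &
    forall a : A, a != 0 -> exists2 g, g \in G &
      exists i, vanishes oo ((val a - val (y ^+ i * g)) / val a).
Proof.
move=> mp noy; have [ip _ _] := mp; have [p0 _] := ip.
have np0 u : ~ p u -> u != 0 by move=> npu; apply: contra_notN npu => /eqP ->.
pose X f := exists2 u : A, ~ p u & val u = f.
have [f [u npu <-]|G GX lead] := finite_leading_terms noy (X := X).
  by split; [exact: valP | rewrite coef_val_neq0; apply: np0].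
have /choice [lift liftP] : forall f, exists u : A, X f -> ~ p u /\ val u = f.
  by move=> f; have [[u npu uf]|] := pselect (X f); [exists u|exists 0].
exists (map lift G) => [g /mapP [f Gf ->]|]; first by have [] := liftP f (GX f Gf).
have main a : ~ p a -> exists2 g, g \in map lift G &
    exists i, vanishes oo ((val a - val (y ^+ i * g)) / val a).
  move=> npa; have [|f Gf [i vi]] := lead (val a); first by exists a.
  exists (lift f); first exact: map_f.
  have [_ liftE] := liftP f (GX f Gf); exists i.
  have -> : val (y ^+ i * lift f) = val y ^+ i * val (lift f).
    by rewrite rmorphM rmorphXn.
  by rewrite liftE.
move=> a a0; have [pa|] := pselect (p a); last exact: main.
have noa : val a \notin oo.
  apply/negP => ooa; apply: (maximal_ideal_proper mp).
  by have [v <-] := coef_unit a0 ooa; apply: idealM.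
have npa1 : ~ p (a + 1).
  move=> pa1; apply: (maximal_ideal_proper mp).
  by have := idealB ip pa1 pa; rewrite addrAC subrr add0r.
have [g Gg [i vi]] := main _ npa1; exists g => //; exists i.
have va0 : val a != 0 by rewrite coef_val_neq0.
have va10 : val a + 1 != 0.
  by have := np0 _ npa1; rewrite -coef_val_neq0 rmorphD rmorph1.
have vaV := vanishes_notin noa.
rewrite rmorphD rmorph1 in vi.
have -> : (val a - val (y ^+ i * g)) / val a =
    (1 + (val a)^-1) * ((val a + 1 - val (y ^+ i * g)) / (val a + 1)) - (val a)^-1.
  by move: (val (y ^+ i * g)) => u; field; rewrite va0 va10.
apply: vanishesD; last by rewrite vanishesN.
by apply: vanishesM => //; apply: rpredD (rpred1 _) (vanishes_in vaV).
Qed.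

End LevelAssumption.

Theorem proposition2p2p5 (Fq : finFieldType)
    (F : fieldExtType {fraction {poly Fq}}) (oo : place F)
    (p a : set (coef_ring oo)) :
  is_maximal_ideal p -> is_ideal a -> ~ (a `<=` p) ->
  exists N : set (coef_ring oo),
    [/\ is_ideal N, N <> [set 0], N <> setT, N `<=` a & ~ (N `<=` p)] /\
    level_assumption N.
Proof.
move=> mp ia nap; have [ip _ _] := mp; have [p0 _] := ip.
have [z az npz] : exists2 z, a z & ~ p z.
  apply: contrapT => noz; apply: nap => z az; apply: contrapT => npz.
  by apply: noz; exists z.
have [y [npy noy]] := exists_coef_notin_maximal mp.
have [G npG lead] := leading_terms_notin_maximal mp noy.
(* The factor [z] puts [N] inside the ideal [a], and [y], with its pole at [oo], makes [N] proper.
   As [y] and the members of [G] divide [x], each [y ^+ i * g] is a product of elements of [D]. *)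
pose x := z * (y * \prod_(g <- G) g).
have npx : ~ p x.
  by do 2!apply: maximal_ideal_prime => //; apply: maximal_ideal_prod.
have np0 u : ~ p u -> u != 0 by move=> npu; apply: contra_notN npu => /eqP ->.
have x0 := np0 x npx.
have [l lM gen] := power_divisor_generated x0.
set D := [set b | _] in gen.
have Mx : power_divisor x x by exists 1%N, 1; rewrite mul1r expr1.
have MM b c : power_divisor x b -> power_divisor x c -> power_divisor x (b * c).
  by move=> [k bk] [k' ck']; exists (k + k')%N; rewrite exprD; apply: principal_mul.
have M1 : power_divisor x 1 by exists 0%N, 1; rewrite mul1r expr0.
have MX b n : power_divisor x b -> power_divisor x (b ^+ n).
  by move=> Mb; elim: n => // n IH; rewrite exprS; apply: MM.
have Mdvd b c : principal_ideal b c -> power_divisor x c -> power_divisor x b.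
  by move=> bc [k ck]; exists k; apply: principal_trans ck.
have Mp b : power_divisor x b -> ~ p b.
  move=> [k [c xE]] pb; have : ~ p (x ^+ k).
    elim: (k) => [|j IH]; first by rewrite expr0; apply: maximal_ideal_proper.
    by rewrite exprS; apply: maximal_ideal_prime.
  by apply; rewrite xE; apply: idealM.
pose P := \prod_(b <- l) b.
have MP : power_divisor x P.
  rewrite /P; elim: (l) lM => [|b s IH] sM; first by rewrite big_nil.
  rewrite big_cons; apply: MM; first by apply: sM; rewrite inE eqxx.
  by apply: IH => c sc; apply: sM; rewrite inE sc orbT.
pose n := P * P * x.
have Mn : power_divisor x n := MM _ _ (MM _ _ MP MP) Mx.
have npn := Mp n Mn.
(* Units divide everything, so all of [D] divides [P], and a product of two members divides
   [P * P]. *)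
have DP b : D b -> principal_ideal b P.
  move=> [/principal_prod //|[b0 oob]].
  by have [v vb] := coef_unit b0 oob; exists (P * v); rewrite -mulrA vb mulr1.
have Dn b : principal_ideal b (P * P) -> Div (principal_ideal n) b.
  by move=> bP; apply/Div_principal; apply: principal_trans bP (principal_mulr _ _).
have nn : principal_ideal n n by exists 1; rewrite mul1r.
exists (principal_ideal n); split; first split.
- exact: principal_is_ideal.
- by move=> N0; move: nn; rewrite N0 => n0; apply: npn; rewrite n0.
(* Otherwise [y] has an inverse in [A]; it vanishes at [oo], so it has no pole anywhere and hence no
   zero, contradicting the pole of [y]. *)
- move=> NT; have [c cE] : principal_ideal n 1 by rewrite NT.
  have y0 := np0 y npy; have vy0 : val y != 0 by rewrite coef_val_neq0.
  have [v vE] : principal_ideal y 1.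
    apply: (principal_trans (b := n)); last by exists c.
    by exists (P * P * (z * \prod_(g <- G) g)); rewrite /n /x; ring.
  have vV : val v = (val y)^-1.
    by apply: (mulIf vy0); rewrite mulVf // -rmorphM -vE rmorph1.
  have v0 : val v != 0 by rewrite vV invr_eq0.
  have oov : val v \in oo by rewrite vV; apply: vanishes_in; apply: vanishes_notin.
  have [_] := regular_inv (valP v) oov v0.
  by rewrite vV invrK (negPf noy).
- move=> _ [c ->].
  rewrite /n /x (_ : _ * _ = c * (P * P * (y * \prod_(g <- G) g)) * z); last by ring.
  exact: idealM.
- by move=> /(_ n nn).
exists D.
  by move=> b Db; apply: Dn; apply: principal_trans (DP b Db) (principal_mulr _ _).
split.
- move=> b b0; have [g Gg [i vi]] := lead b b0.
  have Mg : power_divisor x g.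
    apply: Mdvd Mx; apply: principal_trans (principal_prod Gg) _.
    by exists (z * y); rewrite /x mulrA.
  have My : power_divisor x y.
    by apply: Mdvd Mx; exists (z * \prod_(h <- G) h); rewrite /x; ring.
  have Myg : power_divisor x (y ^+ i * g) by apply: MM => //; apply: MX.
  exists (y ^+ i * g); split; first exact: np0 (Mp _ Myg).
    exact: gen.
  by apply: deg_lt => //; rewrite rmorphB.
- by move=> b c Db Dc _; apply: Dn; apply: principal_mul; apply: DP.
- by move=> b /Div_principal bn; apply: gen; apply: Mdvd Mn.
- by exists n.
Qed.
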